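(* Let $\mathcal{X}$ and $\mathcal{Y}$ be finite, let $c:\mathcal{X}\times\mathcal{Y}\to\mathbb{R}_+$ be a cost function, and let $\mu\in\mathcal{M}_s(\mathcal{X}^{\mathbb{N}})$ and $\nu\in\mathcal{M}_s(\mathcal{Y}^{\mathbb{N}})$ be ergodic. Let $X=X_1,X_2,\ldots$ and $Y=Y_1,Y_2,\ldots$ be processes with distributions $\mu$ and $\nu$, respectively. Then for any $\eta>0$ there exists a sequence $k=k(n)$ with $k(n)\to\infty$ such that, almost surely as $n\to\infty$, $\tilde S^\eta_{k(n),n}\to S^\eta(\mu,\nu)$ and $\tilde\lambda^{\eta,k(n),n}\Rightarrow\mathcal{J}^\eta_{\min}(\mu,\nu)$.
   Context: Spaces and measures: finite sets carry the discrete topology and sequence spaces the product topology. $\mathcal{M}(\mathcal{U})$ is the set of Borel probability measures on $\mathcal{U}$; $\mathcal{M}_s(\mathcal{U}^{\mathbb{N}})$ is the set of those on $\mathcal{U}^{\mathbb{N}}$ invariant under the left shift; $\mathcal{X}^{\mathbb{N}}\times\mathcal{Y}^{\mathbb{N}}$ is identified with $(\mathcal{X}\times\mathcal{Y})^{\mathbb{N}}$. Ergodic: shift-invariant measurable sets have measure 0 or 1. $\gamma_k$ is the law of the first $k$ coordinates under $\gamma$. Entropy: for a probability measure $p$ on a finite set, $H(p)=-\sum_up(u)\log p(u)$; for stationary $\gamma$ on a finite-alphabet sequence space, the entropy rate is $h(\gamma)=\lim_{k\to\infty}\frac1kH(\gamma_k)$. Entropic problems: $\Pi(\alpha,\beta)$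 is the set of couplings. For finite sets and a cost $d$, $T^\eta_d(\alpha,\beta)=\inf_{\pi\in\Pi(\alpha,\beta)}\{\int d\,d\pi-\eta H(\pi)\}$. $\mathcal{J}(\mu,\nu)$ is the set of joinings (stationary couplings) of $\mu$ and $\nu$. $S^\eta(\mu,\nu)=\inf_{\lambda\in\mathcal{J}(\mu,\nu)}\{\int c\,d\lambda_1-\eta h(\lambda)\}$, and $\mathcal{J}^\eta_{\min}(\mu,\nu)$ is the set of joinings attaining this infimum. $c_k(x_1^k,y_1^k)=\sum_{\ell=1}^kc(x_\ell,y_\ell)$. Estimators, for $1\le k\le n$: $\hat\mu_{k,n}(x_1^k)=\frac1{n-k+1}\sum_{\ell=0}^{n-k}\mathbb{1}(x_1^k=X_{\ell+1}^{\ell+k})$, and $\hat\nu_{k,n}$ is defined in the same way from $Y_1^n$. Let $\pi_k$ be any minimizer of $\int c_k\,d\pi-\eta H(\pi)$ over $\pi\in\Pi(\hat\mu_{k,n},\hat\nu_{k,n})$. Set $\tilde S^\eta_{k,n}=k^{-1}T^\eta_{c_k}(\hat\mu_{k,n},\hat\nu_{k,n})$ and $\tilde\lambda^{\eta,k,n}=\Lambda^k[\pi_k]$, where for a finite set $\mathcal{U}$ and $\gamma\in\mathcal{M}(\mathcal{U}^k)$, $\tilde\Lambda^k[\gamma]\in\mathcal{M}(\mathcal{U}^{\mathbb{N}})$ is the measure under which consecutive non-overlapping $k$-blocks are i.i.d. with law $\gamma$, and $\Lambda^k[\gamma](A)=\frac1k\sum_{\ell=0}^{k-1}\tilde\Lambda^k[\gamma](\mathcal{U}^\ell\times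 A)$ (here $\mathcal{U}=\mathcal{X}\times\mathcal{Y}$ with $\mathcal{X}^k\times\mathcal{Y}^k$ identified with $\mathcal{U}^k$). Conventions: $k(n)$ is deterministic with $1\le k(n)\le n$. $X$ and $Y$ may be defined on different probability spaces and nothing is assumed about their joint dependence; ''almost surely'' means for all $X$ in a set of $\mu$-measure one and all $Y$ in a set of $\nu$-measure one. $\gamma^n\Rightarrow\Gamma$ for a set $\Gamma$ of measures means that every subsequence of $\gamma^n$ has a further subsequence converging weakly to an element of $\Gamma$. *)

(* Defs.v *)
From HB Require Import structures.
From mathcomp Require Import all_boot all_order all_algebra.
From mathcomp Require Import all_classical all_reals all_analysis.

Set Implicit Arguments.
Unset Strict Implicit.
Unset Printing Implicit Defensive.

Import Order.TTheory GRing.Theory Num.Theory.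
Import numFieldNormedType.Exports.

Local Open Scope classical_set_scope.
Local Open Scope ring_scope.

(* Nonempty finite alphabets: measurable spaces are pointed in the library. A
   finite set carrying a probability measure on its sequences is nonempty. *)
#[short(type="pfinType")]
HB.structure Definition PointedFinite := {T of Finite T & isPointed T}.

HB.instance Definition _ (T T' : pfinType) := Pointed.on (T * T')%type.

Lemma continuous_to_prod (I : Type) (K : I -> topologicalType)
    (S : topologicalType) (f : S -> prod_topology K) :
  (forall i, continuous (fun s => f s i)) -> continuous f.
Proof.
move=> fc x.
pose Ts i : Topological (forall i, K i) :=
  Topological.class (initial_topology (fun g : forall i, K i => g i)).
have Ff : Filter (f @ x).
  exact: (@fmap_filter _ _ f (nbhs x) (nbhs_filter x)).
apply: (proj2 (@cvg_sup (forall i, K i) I Ts (f @ x) (f x) Ff)) => i.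
exact: (@continuous_comp_initial _ S (K i) (fun g : forall i, K i => g i) f
  (fc i) x).
Qed.

(* Coordinates are numbered from 0: the n-th coordinate of x is x_(n+1) in
   1-based notation. *)
Definition seqsp (U : pfinType) : Type :=
  prod_topology (fun _ : nat => discrete_topology U).

HB.instance Definition _ (U : pfinType) := Topological.on (seqsp U).
HB.instance Definition _ (U : pfinType) :=
  isPointed.Build (seqsp U) (fun _ => point).

Definition borel_display : measure_display. Proof. by constructor. Qed.

Section borel.
Variable U : pfinType.

Definition borel : set (set (seqsp U)) := <<s @open (seqsp U) >>.

Let borel0 : borel set0.
Proof. exact: sigma_algebra0. Qed.

Let borelC (A : set (seqsp U)) : borel A -> borel (~` A).
Proof. exact: sigma_algebraC. Qed.

Let borel_bigcup (F : (set (seqsp U))^nat) :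
  (forall i, borel (F i)) -> borel (\bigcup_i F i).
Proof. exact: sigma_algebra_bigcup. Qed.

HB.instance Definition _ := @isMeasurable.Build borel_display (seqsp U) borel
  borel0 borelC borel_bigcup.

Definition shift (l : nat) (x : seqsp U) : seqsp U := fun n => x (l + n)%N.

Lemma continuous_shift l : continuous (@shift l).
Proof.
apply: (@continuous_to_prod nat (fun=> discrete_topology U) (seqsp U)) => i.
exact: (@proj_continuous nat (fun=> discrete_topology U) (l + i)%N).
Qed.

Lemma measurable_shift l : measurable_fun [set: seqsp U] (shift l).
Proof.
apply: (@measurability _ _ _ _ _ (shift l) (@open (seqsp U))) => //.
move=> _ [B oB <-]; rewrite setTI; apply: sub_sigma_algebra.
by apply: open_comp => // x _; exact: continuous_shift.
Qed.

HB.instance Definition _ l :=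
  isMeasurableFun.Build _ _ _ _ (shift l) (@measurable_shift l).

End borel.

Section definitions.
Variable R : realType.

Definition shift_invariant (U : pfinType) (gam : probability (seqsp U) R) :=
  forall A, measurable A -> gam (@shift U 1 @^-1` A) = gam A.

Definition ergodic (U : pfinType) (gam : probability (seqsp U) R) :=
  forall A, measurable A -> @shift U 1 @^-1` A = A ->
    gam A = 0%E \/ gam A = 1%E.

(* Probability measures on finite sets are represented by their mass
   functions. *)

Definition is_pmf (A : finType) (p : A -> R) :=
  (forall a, 0 <= p a) /\ \sum_a p a = 1.

Definition expect (A : finType) (p f : A -> R) : R := \sum_a f a * p a.

(* [ln 0 = 0] in the library, hence the convention 0 log 0 = 0. *)
Definition entropy (A : finType) (p : A -> R) : R := - \sum_a p a * ln (p a).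

Definition couplings (A B : finType) (al : A -> R) (be : B -> R) :
    set (A * B -> R) :=
  [set p | [/\ is_pmf p, forall a, \sum_b p (a, b) = al a &
                         forall b, \sum_a p (a, b) = be b]].

Definition eot_obj (A B : finType) (d : A * B -> R) (eta : R)
    (p : A * B -> R) : R :=
  expect p d - eta * entropy p.

(* The infimum is over a nonempty bounded set as soon as [al] and [be] are mass
   functions, so the value of [inf] on other sets plays no role; likewise for
   [eoj] below. *)
Definition eot (A B : finType) (d : A * B -> R) (eta : R)
    (al : A -> R) (be : B -> R) : R :=
  inf [set eot_obj d eta p | p in couplings al be].

Definition eot_minimizers (A B : finType) (d : A * B -> R) (eta : R)
    (al : A -> R) (be : B -> R) : set (A * B -> R) :=
  [set p | couplings al be p /\
    forall q, couplings al be q -> eot_obj d eta p <= eot_obj d eta q].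

Definition block (k : nat) (U : finType) : finType := {ffun 'I_k -> U}.

Definition block_law (U : pfinType) (k : nat) (gam : probability (seqsp U) R) :
    block k U -> R :=
  fun u => fine (gam [set x | forall i : 'I_k, x i = u i]).

Definition entropy_rate (U : pfinType) (gam : probability (seqsp U) R) : R :=
  limn (fun k => k%:R^-1 * entropy (@block_law U k gam)).

Section costs.
Variables (X Y : pfinType) (c : X * Y -> R).

Definition block_cost (k : nat) (w : block k X * block k Y) : R :=
  \sum_(l < k) c (w.1 l, w.2 l).

Definition seq_fst (z : seqsp (X * Y)%type) : seqsp X := fun n => (z n).1.
Definition seq_snd (z : seqsp (X * Y)%type) : seqsp Y := fun n => (z n).2.

Definition joinings (mu : probability (seqsp X) R)
    (nu : probability (seqsp Y) R) :
    set (probability (seqsp (X * Y)%type) R) :=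
  [set lam | [/\ shift_invariant lam,
    forall A, measurable A -> lam (seq_fst @^-1` A) = mu A &
    forall B, measurable B -> lam (seq_snd @^-1` B) = nu B]].

(* The first term is the integral of the cost against the law of the first
   coordinate. *)
Definition eoj_obj (eta : R) (lam : probability (seqsp (X * Y)%type) R) : R :=
  expect (@block_law _ 1 lam) (fun u => c (u ord0)) - eta * entropy_rate lam.

Definition eoj (eta : R) (mu : probability (seqsp X) R)
    (nu : probability (seqsp Y) R) : R :=
  inf [set eoj_obj eta lam | lam in joinings mu nu].

Definition eoj_min (eta : R) (mu : probability (seqsp X) R)
    (nu : probability (seqsp Y) R) :
    set (probability (seqsp (X * Y)%type) R) :=
  [set lam | joinings mu nu lam /\ eoj_obj eta lam = eoj eta mu nu].

End costs.

Definition empirical (U : pfinType) (k n : nat) (x : seqsp U) : block k U -> R :=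
  fun u => (n - k + 1)%:R^-1 *
    \sum_(0 <= l < n - k + 1) ([forall i : 'I_k, u i == x (l + i)%N] : nat)%:R.

Definition entropic_estimator (X Y : pfinType) (c : X * Y -> R) (eta : R)
    (k n : nat) (x : seqsp X) (y : seqsp Y) : R :=
  k%:R^-1 * eot (@block_cost X Y c k) eta (@empirical X k n x) (@empirical Y k n y).

(* The consecutive k-blocks of the sequence are i.i.d. with law [g]: the joint
   law of the first m blocks is the m-fold product of [g], for all m. *)
Definition blocks_iid (U : pfinType) (k : nat) (g : block k U -> R)
    (P : probability (seqsp U) R) :=
  forall (m : nat) (w : 'I_m -> block k U),
    P [set x | forall (j : 'I_m) (i : 'I_k), x (j * k + i)%N = w j i]
    = (\prod_(j < m) g (w j))%:E.

(* For k > 0 and a probability mass function [g] there is exactly one such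
   measure, and [xget] selects it; in the other cases the value is
   irrelevant. *)
Definition iid_block_measure (U : pfinType) (k : nat) (g : block k U -> R) :
    probability (seqsp U) R :=
  xget point [set P | blocks_iid g P].

(* [shift l @^-1` A] is the set U^l x A. *)
Definition randomized_block_measure (U : pfinType) (k : nat)
    (g : block k U -> R) : {measure set (seqsp U) -> \bar R} :=
  mscale (k%:R^-1 : R)%:nng
    (msum (fun l => distribution (iid_block_measure g) (@shift U l)) k).

Definition pair_block_law (X Y : pfinType) (k : nat)
    (p : block k X * block k Y -> R) : block k (X * Y)%type -> R :=
  fun u => p ([ffun i => (u i).1], [ffun i => (u i).2]).

Definition joining_estimator (X Y : pfinType) (k : nat)
    (p : block k X * block k Y -> R) :
    {measure set (seqsp (X * Y)%type) -> \bar R} :=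
  randomized_block_measure (pair_block_law p).

Definition weak_cvg (U : pfinType)
    (gam : nat -> {measure set (seqsp U) -> \bar R})
    (lam : {measure set (seqsp U) -> \bar R}) :=
  forall f : seqsp U -> R, continuous f -> bounded_fun f ->
    (\int[gam n]_z (f z)%:E @[n --> \oo] --> \int[lam]_z (f z)%:E)%E.

Definition weak_cvg_set (U : pfinType)
    (gam : nat -> {measure set (seqsp U) -> \bar R})
    (G : set (probability (seqsp U) R)) :=
  forall s : nat -> nat, {homo s : m n / (m < n)%N} ->
    exists t : nat -> nat, {homo t : m n / (m < n)%N} /\
      exists2 lam, G lam & weak_cvg (fun m => gam (s (t m))) lam.

End definitions.

(* Main.v *)
Require Import Defs.
From HB Require Import structures.
From mathcomp Require Import all_boot all_order all_algebra.
From mathcomp Require Import all_classical all_reals all_analysis.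
From mathcomp Require Import measurable_realfun ring lra.

(** The estimators are squeezed between two bounds that meet in the limit.

    Upper bound. The ergodic theorem makes the empirical law of [k]-blocks close
    to the true one when the sample is long compared to [k]. Closeness is only
    needed in the form [(1 - th) * block_law mu u <= empirical k n x u], with [th]
    tending to zero: the block law of an arbitrary joining, scaled by [1 - th], can
    then be completed into a coupling of the empirical laws by an independent
    coupling of the leftover masses, and concavity of the entropy bounds its
    objective (eot_le_perturb). As the entropy rate is the infimum of the
    normalized block entropies, the estimator is at most [1 - th] times the
    objective of any joining, plus [th] times a constant (estimator_le).

    Lower bound. Reading a block cyclically from a uniformly chosen position turns
    a coupling of block laws into a consistent and shift invariant family of word
    laws (cyclic_words), which differs from the stationary measure built on
    independent blocks by a boundary term of order [1 / k]
    (randomized_block_measure_cyl). Along a subsequence the word laws converge to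
    those of a stationary measure, which is a joining because its marginals dominate
    [mu] and [nu] (limit_marginal). The mean cost passes to the limit, and
    subadditivity and concavity show that the entropy per letter of a block law is,
    up to a vanishing term, at most the normalized entropy of its averaged cyclic
    windows of any fixed length (entropy_cyclic_avg). So the objective of the limit
    joining is at most the limit of the estimators (limit_joining), and by the
    upper bound this joining is optimal (limit_minimizing).

    Only lower bounds on frequencies are needed. By Garsia's form of the maximal
    ergodic inequality, the frequency of a word is eventually at least any fixed
    proportion, smaller than one, of its probability (visits_lower_bound); the
    exceptional set, where the deficit of visits is unbounded, is exactly shift
    invariant, so ergodicity applies to it directly. Thresholds on the sample size
    for each [k], and the lemma of Borel and Cantelli, then give a deterministic
    block length (eventually_sampled_blocks, slow_sequence). *)

Set Implicit Arguments.
Unset Strict Implicit.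
Unset Printing Implicit Defensive.

Import Order.TTheory GRing.Theory Num.Theory.
Import numFieldNormedType.Exports.

Local Open Scope classical_set_scope.
Local Open Scope ring_scope.

(** * Entropy of finite distributions *)

Section finite_entropy.
Variable R : realType.
Implicit Types A B : finType.

Definition image_law A B (f : A -> B) (p : A -> R) : B -> R :=
  fun b => \sum_(a | f a == b) p a.

Lemma sum_image_law A B (f : A -> B) (p : A -> R) (F : B -> R) :
  \sum_b image_law f p b * F b = \sum_a p a * F (f a).
Proof.
rewrite [RHS](partition_big f predT) //=; apply: eq_bigr => b _.
by rewrite /image_law big_distrl /=; apply: eq_bigr => a /eqP->.
Qed.

Lemma image_law_sum A B (f : A -> B) (p : A -> R) (Q : pred B) :
  \sum_(b | Q b) image_law f p b = \sum_(a | Q (f a)) p a.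
Proof.
rewrite [RHS](partition_big f Q) //=; apply: eq_bigr => b Qb.
by apply: eq_bigl => a; case: eqP => [->|]; rewrite ?Qb ?andbF.
Qed.

Lemma image_law_pmf A B (f : A -> B) (p : A -> R) :
  is_pmf p -> is_pmf (image_law f p).
Proof.
move=> [p0 p1]; split; first by move=> b; exact: sumr_ge0.
under eq_bigr => b _ do rewrite -[image_law f p b]mulr1.
by rewrite (@sum_image_law A B f p (fun=> 1)); under eq_bigr do rewrite mulr1.
Qed.

Lemma sum_pair A B (F : A * B -> R) : \sum_w F w = \sum_a \sum_b F (a, b).
Proof. by rewrite pair_bigA /=; apply: eq_bigr => -[]. Qed.

Lemma image_law_gt0 A B (f : A -> B) (p : A -> R) a :
  is_pmf p -> 0 < p a -> 0 < image_law f p (f a).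
Proof.
move=> [p0 _] pa; rewrite /image_law (bigD1 a) //=.
by rewrite ltr_pwDl // sumr_ge0.
Qed.

Lemma pmf_le1 A (p : A -> R) a : is_pmf p -> p a <= 1.
Proof.
by move=> [p0 <-]; rewrite (bigD1 a) //= lerDl sumr_ge0.
Qed.

Lemma ler_sum_inj A B (h : A -> B) (F : B -> R) :
  injective h -> (forall b, 0 <= F b) -> \sum_a F (h a) <= \sum_b F b.
Proof.
move=> hinj F0; under eq_bigr => a _ do rewrite -[F (h a)]mul1r.
rewrite -(@sum_image_law A B h (fun=> 1) F); apply: ler_sum => b _.
rewrite -[leRHS]mul1r ler_wpM2r // /image_law.
have [a /= /eqP <-|none] := pickP [pred a | h a == b].
  by rewrite (big_pred1 a) // => a'; rewrite /= inj_eq.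
by rewrite big_pred0.
Qed.

(** The inequality of Gibbs, from which the other bounds on entropy follow. It
    is the sum over [a] of [p a * ln (q a / p a) <= q a - p a]. *)
Lemma gibbs A (p q : A -> R) : is_pmf p -> (forall a, 0 <= q a) ->
  \sum_a q a <= 1 -> (forall a, 0 < p a -> 0 < q a) ->
  entropy p <= - \sum_a p a * ln (q a).
Proof.
move=> [p0 p1] q0 q1 pq; rewrite /entropy lerN2 -subr_le0 -sumrB.
apply: (@le_trans _ _ (\sum_a (q a - p a))); last first.
  by rewrite sumrB p1 subr_le0.
apply: ler_sum => a _; have := p0 a; rewrite le_eqVlt => /orP[/eqP <-|pa].
  by rewrite !mul0r !subr0.
have qa := pq a pa.
rewrite -mulrBr -ln_div ?posrE//.
have -> : q a / p a = 1 + (q a / p a - 1) by rewrite addrC subrK.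
have h : -1 < q a / p a - 1 by rewrite ltrBDr addrC subrr divr_gt0.
apply: (le_trans (ler_wpM2l (ltW pa) (le_ln1Dx h))).
by rewrite mulrBr mulr1 mulrCA divff ?mulr1 ?gt_eqF.
Qed.

Lemma entropy_ge0 A (p : A -> R) : is_pmf p -> 0 <= entropy p.
Proof.
move=> pp; rewrite /entropy oppr_ge0; apply: sumr_le0 => a _.
by rewrite mulr_ge0_le0 ?(pp.1 a) // ln_le0 // pmf_le1.
Qed.

Lemma pmf_card_gt0 A (p : A -> R) : is_pmf p -> (0 < #|A|)%N.
Proof.
move=> [_ p1]; rewrite lt0n; apply/eqP => /card0_eq A0.
by move: p1; rewrite big_pred0 // => /eqP; rewrite eq_sym oner_eq0.
Qed.

Lemma entropy_le_ln_card A (p : A -> R) : is_pmf p -> entropy p <= ln #|A|%:R.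
Proof.
move=> pp; have A0 : (0 : R) < #|A|%:R by rewrite ltr0n (pmf_card_gt0 pp).
have [p0 p1] := pp.
apply: (le_trans (@gibbs A p (fun=> #|A|%:R^-1) pp _ _ _)).
- by move=> a; rewrite invr_ge0 ltW.
- by rewrite sumr_const -[leLHS]mulr_natr le_eqVlt; apply/orP; left; apply/eqP;
  apply: mulVf; rewrite gt_eqF.
- by move=> a _; rewrite invr_gt0.
- by rewrite -mulr_suml p1 mul1r lnV ?posrE// opprK.
Qed.

(** Subadditivity: the product of the laws of the [f j] is a mass function whose
    restriction to the image of the jointly injective family [f] can be compared
    with [p]. *)
Lemma entropy_subadditive A B n (f : 'I_n -> A -> B) (p : A -> R) :
  is_pmf p -> (forall a a', (forall j, f j a = f j a') -> a = a') ->
  entropy p <= \sum_j entropy (image_law (f j) p).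
Proof.
move=> pp finj.
pose q a := \prod_j image_law (f j) p (f j a).
have ipp j : is_pmf (image_law (f j) p) by exact: image_law_pmf.
have qgt0 a : 0 < p a -> 0 < q a.
  by move=> pa; apply: prodr_gt0 => j _; exact: image_law_gt0.
apply: (le_trans (@gibbs A p q pp _ _ qgt0)).
- by move=> a; apply: prodr_ge0 => j _; exact: (ipp j).1.
- pose h a : {ffun 'I_n -> B} := [ffun j => f j a].
  pose Q (b : {ffun 'I_n -> B}) := \prod_j image_law (f j) p (b j).
  have Q0 b : 0 <= Q b by apply: prodr_ge0 => j _; exact: (ipp j).1.
  have hinj : injective h.
    move=> a a' /ffunP e; apply: finj => j; have := e j; by rewrite !ffunE.
  have -> : \sum_a q a = \sum_a Q (h a).
    by apply: eq_bigr => a _; apply: eq_bigr => j _; rewrite ffunE.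
  have Q1 : \sum_b Q b = 1.
    rewrite /Q -(bigA_distr_bigA (fun j b => image_law (f j) p b)) /=.
    by rewrite big1 // => j _; exact: (ipp j).2.
  by rewrite -Q1; exact: ler_sum_inj.
- have -> : \sum_j entropy (image_law (f j) p) =
      - \sum_a \sum_j p a * ln (image_law (f j) p (f j a)).
    rewrite exchange_big /= -sumrN; apply: eq_bigr => j _.
    by rewrite /entropy sum_image_law.
  rewrite lerN2; apply: ler_sum => a _.
  have := pp.1 a; rewrite le_eqVlt => /orP[/eqP <-|pa].
    by rewrite mul0r big1 // => j _; rewrite mul0r.
  rewrite -mulr_sumr ler_pM2l // /q.
  have : forall s : seq 'I_n, \sum_(j <- s) ln (image_law (f j) p (f j a)) =
      ln (\prod_(j <- s) image_law (f j) p (f j a)).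
    elim=> [|j s IH]; first by rewrite !big_nil ln1.
    rewrite !big_cons IH lnM ?posrE ?image_law_gt0//.
    by apply: prodr_gt0 => i _; exact: image_law_gt0.
  by move=> ->.
Qed.

(** Concavity, by comparison of each component [p i] with the mixture. *)
Lemma entropy_concave A (I : finType) (w : I -> R) (p : I -> A -> R) :
  is_pmf w -> (forall i, is_pmf (p i)) ->
  \sum_i w i * entropy (p i) <= entropy (fun a => \sum_i w i * p i a).
Proof.
move=> [w0 w1] pp; pose q a := \sum_i w i * p i a.
have q0 a : 0 <= q a by apply: sumr_ge0 => i _; rewrite mulr_ge0 ?(pp i).1.
have -> : entropy q = \sum_i w i * - \sum_a p i a * ln (q a).
  rewrite /entropy /q.
  under eq_bigr => a _ do rewrite mulr_suml.
  rewrite exchange_big /= -sumrN; apply: eq_bigr => i _.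
  rewrite mulrN mulr_sumr; congr (- _); apply: eq_bigr => a _.
  by rewrite mulrA.
apply: ler_sum => i _.
have := w0 i; rewrite le_eqVlt => /orP[/eqP <-|wi]; first by rewrite !mul0r.
rewrite ler_pM2l //; apply: gibbs => //.
- rewrite /q exchange_big /=.
  by under eq_bigr => j _ do rewrite -mulr_sumr (pp j).2 mulr1; rewrite w1.
- move=> a pa; rewrite /q (bigD1 i) //= ltr_pwDl ?mulr_gt0//.
  by apply: sumr_ge0 => j _; rewrite mulr_ge0 ?(pp j).1.
Qed.

Lemma entropy_bij A B (f : A -> B) (g : B -> A) (p : A -> R) :
  cancel f g -> cancel g f -> entropy (fun b => p (g b)) = entropy p.
Proof.
move=> fK gK; rewrite /entropy; congr (- _).
by rewrite (reindex f) /=; [apply: eq_bigr => a _; rewrite fK | exists g => a _].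
Qed.

(** At a positive point this is continuity of [ln]; at zero it holds because
    the absolute value of [x * ln x] is at most twice the square root of [x]. *)
Lemma cvg_xlnx (u : nat -> R) (x : R) : (forall n, 0 <= u n <= 1) ->
  u @ \oo --> x -> u n * ln (u n) @[n --> \oo] --> x * ln x.
Proof.
move=> u01 ux.
have x0 : 0 <= x.
  rewrite -(cvg_lim (@Rhausdorff R) ux); apply: limr_ge; first exact: cvgP ux.
  by apply: nearW => n; case/andP: (u01 n).
move: x0; rewrite le_eqVlt => /orP[/eqP x0|x0]; last first.
  apply: cvgM => //; apply: continuous_cvg => //.
  exact: continuous_ln.
rewrite -x0 mul0r.
have s0 : - (2 * Num.sqrt (u n)) @[n --> \oo] --> (0 : R).
  rewrite -oppr0 -(mulr0 2) -(@sqrtr0 R); apply: cvgN; apply: cvgMr.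
  by apply: continuous_cvg; [exact: sqrt_continuous|rewrite x0].
apply: (@squeeze_cvgr _ _ _ _ (fun n => - (2 * Num.sqrt (u n))) (fun=> 0)) => //;
  last exact: cvg_cst.
apply: nearW => n; have /andP[un0 un1] := u01 n.
rewrite mulr_ge0_le0 ?ln_le0 // andbT.
move: un0; rewrite le_eqVlt => /orP[/eqP <-|un0].
  by rewrite mul0r sqrtr0 mulr0 oppr0.
set s := Num.sqrt (u n).
have sp : 0 < s by rewrite sqrtr_gt0.
have -> : u n = s * s by rewrite -expr2 sqr_sqrtr // ltW.
rewrite lnM ?posrE // lerNl.
have : ln (1 + (s^-1 - 1)) <= s^-1 - 1.
  by apply: le_ln1Dx; rewrite ltrBDr addrC subrr invr_gt0.
rewrite addrC subrK lnV ?posrE // => h.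
have := ler_wpM2l (ltW (mulr_gt0 sp sp)) h.
have e : s * s * s^-1 = s by rewrite -mulrA divff ?gt_eqF // mulr1.
rewrite mulrBr mulr1 e => h'.
have := mulr_gt0 sp sp; lra.
Qed.

Lemma cvg_sumr (I : Type) (r : seq I) (P : pred I) (f : I -> nat -> R)
    (l : I -> R) : (forall i, P i -> f i n @[n --> \oo] --> l i) ->
  \sum_(i <- r | P i) f i n @[n --> \oo] --> \sum_(i <- r | P i) l i.
Proof. by move=> fl; apply: cvg_big => //; exact: add_continuous. Qed.

Lemma cvg_entropy A (p : nat -> A -> R) (q : A -> R) :
  (forall n, is_pmf (p n)) -> (forall a, p n a @[n --> \oo] --> q a) ->
  entropy (p n) @[n --> \oo] --> entropy q.
Proof.
move=> pp pq; apply: cvgN; apply: cvg_sumr => a _.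
by apply: cvg_xlnx => // n; rewrite (pp n).1 pmf_le1.
Qed.

End finite_entropy.

(** * Entropic optimal transport between finite distributions *)

Section finite_eot.
Variables (R : realType) (A B : finType) (d : A * B -> R) (eta : R).
Hypotheses (d_ge0 : forall w, 0 <= d w) (eta_ge0 : 0 <= eta).

Lemma expect_ge0 (p : A * B -> R) : is_pmf p -> 0 <= expect p d.
Proof. by move=> pp; apply: sumr_ge0 => w _; rewrite mulr_ge0 ?pp.1. Qed.

Lemma eot_obj_lbound (p : A * B -> R) : is_pmf p ->
  - (eta * ln #|{: A * B}|%:R) <= eot_obj d eta p.
Proof.
move=> pp; rewrite /eot_obj -[leLHS]add0r lerB ?expect_ge0 // ler_wpM2l //.
exact: entropy_le_ln_card.
Qed.

Lemma eot_le (al : A -> R) (be : B -> R) (p : A * B -> R) :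
  couplings al be p -> eot d eta al be <= eot_obj d eta p.
Proof.
move=> cp; apply: ge_inf; last by exists p.
by exists (- (eta * ln #|{: A * B}|%:R)) => _ [q [qp _ _] <-]; exact: eot_obj_lbound.
Qed.

Lemma product_coupling (al : A -> R) (be : B -> R) : is_pmf al -> is_pmf be ->
  couplings al be (fun w => al w.1 * be w.2).
Proof.
move=> [al0 al1] [be0 be1].
have e1 a : \sum_b al a * be b = al a by rewrite -mulr_sumr be1 mulr1.
split => //=; last by move=> b; rewrite -mulr_suml al1 mul1r.
split; first by move=> w; rewrite mulr_ge0.
by rewrite sum_pair /=; under eq_bigr do rewrite e1.
Qed.

Lemma eot_near_minimizer (al : A -> R) (be : B -> R) (e : R) :
  is_pmf al -> is_pmf be -> 0 < e ->
  exists2 p, couplings al be p & eot_obj d eta p < eot d eta al be + e.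
Proof.
move=> al1 be1 e0.
have hi : has_inf [set eot_obj d eta p | p in couplings al be].
  split.
    by exists (eot_obj d eta (fun w => al w.1 * be w.2)), (fun w => al w.1 * be w.2);
      [exact: product_coupling|].
  by exists (- (eta * ln #|{: A * B}|%:R)) => _ [q [qp _ _] <-]; exact: eot_obj_lbound.
by have [_ [p cp <-] lt] := inf_adherent e0 hi; exists p.
Qed.

(** If [al'] and [be'] dominate [1 - th] times [al] and [be], the leftover
    masses are coupled independently and added to [1 - th] times the coupling [p].
    Concavity of the entropy bounds the new objective, so that closeness of the
    marginals is only needed in this one-sided, multiplicative sense. *)
Lemma eot_le_perturb (al al' : A -> R) (be be' : B -> R) (p : A * B -> R)
    (th D : R) : 0 < th <= 1 -> is_pmf al' -> is_pmf be' ->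
  (forall a, (1 - th) * al a <= al' a) -> (forall b, (1 - th) * be b <= be' b) ->
  couplings al be p -> (forall w, d w <= D) ->
  eot d eta al' be' <= (1 - th) * eot_obj d eta p + th * D.
Proof.
move=> /andP[th0 th1] [al0 al1] [be0 be1] hal hbe [pp pal pbe] dD.
have thn : th != 0 by rewrite gt_eqF.
have sal : \sum_a al a = 1.
  by rewrite -pp.2 sum_pair; apply: eq_bigr => a _; rewrite pal.
have sbe : \sum_b be b = 1.
  rewrite -pp.2 sum_pair exchange_big /=.
  by apply: eq_bigr => a _; rewrite pbe.
pose r1 a := (al' a - (1 - th) * al a) / th.
pose r2 b := (be' b - (1 - th) * be b) / th.
have r1p : is_pmf r1.
  split; first by move=> a; rewrite divr_ge0 ?(ltW th0) // subr_ge0.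
  rewrite -mulr_suml sumrB -mulr_sumr al1 sal mulr1 opprB addrC subrK.
  by rewrite divff.
have r2p : is_pmf r2.
  split; first by move=> a; rewrite divr_ge0 ?(ltW th0) // subr_ge0.
  rewrite -mulr_suml sumrB -mulr_sumr be1 sbe mulr1 opprB addrC subrK.
  by rewrite divff.
have [[r0 rs] rm1 rm2] := product_coupling r1p r2p.
set r := (fun w : A * B => r1 w.1 * r2 w.2) in r0 rs rm1 rm2.
pose w (b : bool) := if b then 1 - th else th.
pose P (b : bool) := if b then p else r.
pose q x := \sum_b w b * P b x.
have qE x : q x = (1 - th) * p x + th * r x by rewrite /q big_bool.
have w_pmf : is_pmf w.
  split; last by rewrite big_bool /= subrK.
  by move=> b; rewrite /w; case: b; rewrite ?subr_ge0 // ltW.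
have P_pmf b : is_pmf (P b) by case: b.
have q_coupling : couplings al' be' q.
  split.
  - split.
      by move=> x; apply: sumr_ge0 => b _; rewrite mulr_ge0 ?w_pmf.1 ?(P_pmf b).1.
    rewrite /q exchange_big /= -w_pmf.2; apply: eq_bigr => b _.
    by rewrite -mulr_sumr (P_pmf b).2 mulr1.
  - move=> a; under eq_bigr do rewrite qE.
    by rewrite big_split /= -!mulr_sumr pal rm1 /r1 mulrCA divff // mulr1 addrC subrK.
  - move=> b; under eq_bigr do rewrite qE.
    by rewrite big_split /= -!mulr_sumr pbe rm2 /r2 mulrCA divff // mulr1 addrC subrK.
apply: (le_trans (eot_le q_coupling)).
have := entropy_concave w_pmf P_pmf; rewrite big_bool /= => hq.
have hr : 0 <= th * entropy r by rewrite mulr_ge0 ?entropy_ge0 // ltW.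
have eq : expect q d = (1 - th) * expect p d + th * expect r d.
  rewrite /expect !mulr_sumr -big_split /=; apply: eq_bigr => x _.
  by rewrite qE; ring.
have er : expect r d <= D.
  rewrite /expect -[leRHS]mulr1 -rs mulr_sumr; apply: ler_sum => x _.
  by apply: ler_wpM2r; [exact: r0|exact: dD].
have hq' : (1 - th) * entropy p <= entropy q by apply: le_trans hq; rewrite lerDl.
have := ler_wpM2l eta_ge0 hq'; have := ler_wpM2l (ltW th0) er.
rewrite /eot_obj eq; lra.
Qed.

End finite_eot.

(** * Cyclic windows of a finite block *)

Section cyclic_windows.
Variable U : pfinType.

Definition cyc k (u : block k U) (i : nat) : U := nth point (codom u) (i %% k).

Lemma nth_codom_ord T k (x0 : T) (u : 'I_k -> T) (i : 'I_k) :
  nth x0 (codom u) i = u i.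
Proof.
by rewrite /codom /image_mem (nth_map i) ?size_enum_ord // nth_ord_enum.
Qed.

Lemma cyc_ord k (u : block k U) (i : 'I_k) : cyc u i = u i.
Proof. by rewrite /cyc modn_small // nth_codom_ord. Qed.

Lemma cyc_modn k (u : block k U) i : cyc u (i %% k) = cyc u i.
Proof. by rewrite /cyc modn_mod. Qed.

Definition cyclic_window m t k (u : block k U) : block m U :=
  [ffun i : 'I_m => cyc u (t + i)].

Variable R : realType.

Definition cyclic_law k (g : block k U -> R) m t : block m U -> R :=
  image_law (@cyclic_window m t k) g.

Definition cyclic_avg k (g : block k U -> R) m : block m U -> R :=
  fun v => \sum_(t < k) k%:R^-1 * cyclic_law g t v.

Lemma ln_card_block m : ln #|block m U|%:R = m%:R * ln #|U|%:R :> R.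
Proof.
rewrite card_ffun card_ord natrX lnXn ?mulr_natl//.
by rewrite ltr0n; apply/card_gt0P; exists point.
Qed.

Lemma ln_card_ge0 : 0 <= ln #|U|%:R :> R.
Proof. by rewrite ln_ge0 // ler1n; apply/card_gt0P; exists point. Qed.

Lemma entropy_block_le m (p : block m U -> R) : is_pmf p ->
  entropy p <= m%:R * ln #|U|%:R.
Proof. by rewrite -ln_card_block; exact: entropy_le_ln_card. Qed.

(** For each of the [m] phases, consecutive disjoint windows of length [m]
    starting at that phase cover the cycle, and subadditivity applies to them.
    Over all phases every starting point is used once, up to an overlap of at most
    [m] windows where the cycle closes. *)
Lemma entropy_cyclic_windows k (g : block k U -> R) m : is_pmf g -> (0 < k)%N ->
  (0 < m)%N ->
  m%:R * entropy g <=
    \sum_(t < k) entropy (@cyclic_law k g m t) + m%:R ^+ 2 * ln #|U|%:R.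
Proof.
move=> gp k0 m0.
pose F t := entropy (@cyclic_law k g m t).
have F0 t : 0 <= F t by apply: entropy_ge0; exact: image_law_pmf.
have Fle t : F t <= m%:R * ln #|U|%:R.
  by apply: entropy_block_le; exact: image_law_pmf.
pose q := (k %/ m).+1.
have kq : (k <= q * m)%N by rewrite ltnW // ltn_ceil.
have qk : (q * m <= k + m)%N by rewrite mulSn addnC leq_add2r leq_trunc_div.
have step l : entropy g <= \sum_(0 <= j < q) F (j * m + l)%N.
  rewrite big_mkord.
  apply: (@entropy_subadditive _ _ _ _
    (fun j : 'I_q => @cyclic_window m (j * m + l) k)) => //.
  move=> u u' huu; apply/ffunP => i.
  (* [r] is a representative of [i - l] modulo [k], found without subtracting a
     larger number from a smaller one *)
  pose r := ((i + k * l) - l)%N.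
  have lr : (l <= i + k * l)%N by rewrite (leq_trans _ (leq_addl _ _)) // leq_pmull.
  pose r' := (r %% k)%N.
  have r'k : (r' < k)%N by rewrite ltn_mod.
  have jq : (r' %/ m < q)%N by rewrite ltnS leq_div2r // ltnW.
  have im : (r' %% m < m)%N by rewrite ltn_mod.
  have := huu (Ordinal jq) => /ffunP /(_ (Ordinal im)); rewrite !ffunE /=.
  rewrite addnAC -divn_eq -[cyc u (r' + l)]cyc_modn -[cyc u' (r' + l)]cyc_modn.
  rewrite modnDml /r subnK // [(k * l)%N]mulnC addnC modnMDl !cyc_modn.
  by rewrite !cyc_ord.
have -> : m%:R * entropy g = \sum_(0 <= l < m) entropy g.
  by rewrite sumr_const_nat subn0 mulr_natl.
apply: (@le_trans _ _ (\sum_(0 <= t < q * m) F t)).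
  have -> : \sum_(0 <= t < q * m) F t =
      \sum_(0 <= j < q) \sum_(0 <= l < m) F (j * m + l)%N.
    rewrite big_nat_mul; apply: eq_bigr => j _.
    rewrite -{1}[(j * m)%N]add0n big_addn mulSn addnK.
    by apply: eq_bigr => l _; rewrite addnC.
  by rewrite exchange_big_nat /=; apply: ler_sum => l _; exact: step.
rewrite (@big_cat_nat _ _ _ k) //= big_mkord lerD2l.
apply: (@le_trans _ _ (\sum_(k <= t < q * m) m%:R * ln #|U|%:R)).
  by apply: ler_sum => t _; exact: Fle.
rewrite sumr_const_nat -[leLHS]mulr_natl expr2 -[leRHS]mulrA ler_wpM2r //.
  by rewrite mulr_ge0 ?ler0n // ln_card_ge0.
by rewrite ler_nat leq_subLR.
Qed.

Lemma cyclic_law_pmf k (g : block k U -> R) m t :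
  is_pmf g -> is_pmf (@cyclic_law k g m t).
Proof. exact: image_law_pmf. Qed.

Lemma pmf_uniform k : (0 < k)%N -> is_pmf (fun _ : 'I_k => k%:R^-1 : R).
Proof.
move=> k0; split => [t|]; first by rewrite invr_ge0 ler0n.
by rewrite sumr_const card_ord -[LHS]mulr_natr mulVf // pnatr_eq0 -lt0n.
Qed.

Lemma cyclic_avg_pmf k (g : block k U -> R) m :
  is_pmf g -> (0 < k)%N -> is_pmf (@cyclic_avg k g m).
Proof.
move=> gp k0; split=> [v|].
  apply: sumr_ge0 => t _.
  by rewrite mulr_ge0 ?invr_ge0 ?ler0n // (cyclic_law_pmf _ _ gp).1.
rewrite exchange_big /= -[RHS](pmf_uniform k0).2; apply: eq_bigr => t _.
by rewrite -mulr_sumr (cyclic_law_pmf _ _ gp).2 mulr1.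
Qed.

(** The average over starting points of the entropies of the windows is at most the
    entropy of the average law, by concavity. *)
Lemma entropy_cyclic_avg k (g : block k U -> R) m : is_pmf g -> (0 < k)%N ->
  (0 < m)%N ->
  k%:R^-1 * entropy g <=
    m%:R^-1 * entropy (@cyclic_avg k g m) + m%:R * ln #|U|%:R / k%:R.
Proof.
move=> gp k0 m0.
have kR : 0 < k%:R :> R by rewrite ltr0n.
have mR : 0 < m%:R :> R by rewrite ltr0n.
have h1 : \sum_(t < k) entropy (@cyclic_law k g m t) <=
    k%:R * entropy (@cyclic_avg k g m).
  rewrite -ler_pdivrMl // mulr_sumr.
  exact: entropy_concave (pmf_uniform k0) (fun t => @cyclic_law_pmf k g m t gp).
have h2 := le_trans (entropy_cyclic_windows gp k0 m0) (lerD h1 (lexx _)).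
rewrite mulrC ler_pdivrMr // mulrDl divfK ?gt_eqF //.
rewrite -(ler_pM2l mR) (le_trans h2) // le_eqVlt; apply/orP; left; apply/eqP.
by field; rewrite gt_eqF.
Qed.

(** The terms equal to one are the positions in a cycle of length [k] where a
    window of length [m] runs over the end of the cycle. *)
Lemma overlap_count k m : (\sum_(l < k) (k < l + m) <= m)%N.
Proof.
rewrite -(big_mkord xpredT (fun l => nat_of_bool (k < l + m)%N)).
have [mk|mk] := leqP m k; last first.
  apply: (@leq_trans (\sum_(0 <= l < k) 1)%N).
    by apply: leq_sum => l _; exact: leq_b1.
  by rewrite sum_nat_const_nat muln1 subn0 ltnW.
rewrite (@big_cat_nat _ _ _ (k - m)) ?leq_subr //= big_nat big1 ?add0n.
  apply: (@leq_trans (\sum_(k - m <= l < k) 1)%N).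
    by apply: leq_sum => l _; exact: leq_b1.
  by rewrite sum_nat_const_nat muln1 subKn.
by move=> l /andP[_]; rewrite ltn_subRL addnC => lk; rewrite ltnNge ltnW.
Qed.

(** The averaged laws of cyclic windows of all lengths form a single function of
    words, which is exactly consistent and shift invariant (lemmas
    [cyclic_words_rcons] and [cyclic_words_cons]). *)
Definition cyclic_words k (g : block k U -> R) (s : seq U) : R :=
  \sum_(t < k) k%:R^-1 *
    \sum_(u | mkseq (fun i => cyc u (t + i)) (size s) == s) g u.

Lemma codom_cyclic_window m t k (u : block k U) :
  codom (cyclic_window m t u) = mkseq (fun i => cyc u (t + i)) m.
Proof.
apply: (@eq_from_nth _ point); rewrite ?size_mkseq ?size_codom ?card_ord //.
move=> i im; rewrite nth_mkseq // (nth_codom_ord _ _ (Ordinal im)).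
by rewrite ffunE.
Qed.

Lemma codom_block_inj m : injective (fun v : block m U => codom v).
Proof.
move=> v w e; apply/ffunP => i.
by rewrite -[LHS](nth_codom_ord point) -[RHS](nth_codom_ord point) e.
Qed.

Lemma cyclic_lawE k (g : block k U -> R) m t (v : block m U) :
  @cyclic_law k g m t v = \sum_(u | mkseq (fun i => cyc u (t + i)) m == codom v) g u.
Proof.
apply: eq_bigl => u; rewrite -codom_cyclic_window.
exact/esym/(inj_eq (@codom_block_inj m)).
Qed.

Lemma cyclic_avgE k (g : block k U -> R) m v :
  @cyclic_avg k g m v = cyclic_words g (codom v).
Proof.
apply: eq_bigr => t _; congr (_ * _); rewrite cyclic_lawE size_codom.
by rewrite card_ord.
Qed.

Lemma cyclic_words_ge0 k (g : block k U -> R) s :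
  is_pmf g -> 0 <= cyclic_words g s.
Proof.
move=> [g0 _]; apply: sumr_ge0 => t _; rewrite mulr_ge0 ?invr_ge0 ?ler0n //.
exact: sumr_ge0.
Qed.

Lemma cyclic_words_le1 k (g : block k U -> R) s :
  is_pmf g -> (0 < k)%N -> cyclic_words g s <= 1.
Proof.
move=> gp k0; rewrite -[leRHS](pmf_uniform k0).2; apply: ler_sum => t _.
rewrite -[leRHS]mulr1 ler_wpM2l ?invr_ge0 ?ler0n // -gp.2.
rewrite [leRHS](bigID (fun u => mkseq (fun i => cyc u (t + i)) (size s) == s)) /=.
by rewrite lerDl sumr_ge0 // => u _; exact: gp.1.
Qed.

Lemma cyclic_words_nil k (g : block k U -> R) :
  is_pmf g -> (0 < k)%N -> cyclic_words g [::] = 1.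
Proof.
move=> gp k0; rewrite -[RHS](pmf_uniform k0).2; apply: eq_bigr => t _.
by rewrite (eq_bigl xpredT) ?gp.2 ?mulr1.
Qed.

Lemma sum_fiber (A B : finType) (P : pred A) (f : A -> B) (F : A -> R) :
  \sum_b \sum_(a | P a && (f a == b)) F a = \sum_(a | P a) F a.
Proof. by rewrite [RHS](partition_big f predT). Qed.

Lemma cyclic_words_rcons k (g : block k U -> R) s :
  \sum_a cyclic_words g (rcons s a) = cyclic_words g s.
Proof.
rewrite exchange_big /=; apply: eq_bigr => t _; rewrite -mulr_sumr; congr (_ * _).
rewrite -(sum_fiber _ (fun u => cyc u (t + size s))); apply: eq_bigr => a _.
by apply: eq_bigl => u; rewrite size_rcons mkseqS eqseq_rcons.
Qed.

Lemma cyclic_words_cons k (g : block k U -> R) s :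
  \sum_a cyclic_words g (a :: s) = cyclic_words g s.
Proof.
pose G t := k%:R^-1 * \sum_(u | mkseq (fun i => cyc u (t + i)) (size s) == s) g u.
have GS : \sum_a cyclic_words g (a :: s) = \sum_(t < k) G t.+1.
  rewrite exchange_big /=; apply: eq_bigr => t _; rewrite -mulr_sumr; congr (_ * _).
  rewrite -(sum_fiber _ (fun u => cyc u t)); apply: eq_bigr => a _.
  apply: eq_bigl => u; rewrite /mkseq /= eqseq_cons addn0 andbC; congr (_ && _).
  rewrite -[1%N]addn0 iotaDl -map_comp; congr (_ == _); apply: eq_map => i /=.
  by rewrite addnA addn1.
have G0 : G k = G 0%N.
  congr (_ * _); apply: eq_bigl => u; congr (_ == _); apply: eq_mkseq => i.
  by rewrite -cyc_modn modnDl cyc_modn add0n.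
rewrite GS /cyclic_words -/(G) -(big_mkord xpredT G) -(big_mkord xpredT (fun t => G t.+1)).
clear GS; move: G G0; case: (k) => [|k'] G G0; first by rewrite !big_geq.
by rewrite big_nat_recr //= G0 addrC -big_nat_recl.
Qed.

End cyclic_windows.

(** * Cylinders and the Borel structure of a sequence space *)

Section cylinders.
Variable U : pfinType.
Implicit Types (x y : seqsp U) (s : seq U).

Definition cyl s : set (seqsp U) := [set x | mkseq x (size s) = s].

Lemma cylP s x :
  cyl s x <-> (forall i, (i < size s)%N -> x i = nth point s i).
Proof.
split=> [<- i|h].
  by rewrite size_mkseq => ?; rewrite nth_mkseq.
apply: (@eq_from_nth _ point); rewrite size_mkseq // => i im.
by rewrite nth_mkseq // h.
Qed.

Definition agree n x y := forall i, (i < n)%N -> y i = x i.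

Lemma agree_mkseq n x y : agree n x y <-> mkseq y n = mkseq x n.
Proof.
split=> [h|h i im].
  apply: (@eq_from_nth _ point); rewrite !size_mkseq // => i im.
  by rewrite !nth_mkseq // h.
by have := congr1 (fun s => nth point s i) h; rewrite !nth_mkseq.
Qed.

Lemma nbhs_agree x (A : set (seqsp U)) :
  nbhs x A -> exists n, agree n x `<=` A.
Proof.
pose K := fun _ : nat => discrete_topology U.
pose F : set_system (forall i, K i) := fun B => exists n, agree n x `<=` B.
have FF : Filter F.
  split; first by exists 0%N.
  - move=> P Q [n nP] [m mQ]; exists (maxn n m) => y h; split.
      by apply: nP => i im; apply: h; rewrite leq_max im.
    by apply: mQ => i im; apply: h; rewrite leq_max im orbT.
  - by move=> P Q PQ [n nP]; exists n; exact: subset_trans PQ.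
pose Ts i : Topological (forall i, K i) :=
  Topological.class (initial_topology (fun g : forall i, K i => g i)).
have Fx := proj2 (@cvg_sup (forall i, K i) nat Ts F x FF).
move=> Ax; apply: (Fx _ A Ax) => i B [_ [[C oC <-] Cx sCB]].
exists i.+1 => y h; apply: sCB; rewrite /= h //; exact: Cx.
Qed.

Lemma open_coord i (B : set U) : open [set x : seqsp U | B (x i)].
Proof.
have c := @proj_continuous nat (fun=> discrete_topology U) i.
have oB : @open (discrete_topology U) B by apply: discrete_open.
exact: ((continuousP (proj i : seqsp U -> discrete_topology U)).1 c B oB).
Qed.

Lemma cyl_rcons s a : cyl (rcons s a) = cyl s `&` [set x | x (size s) = a].
Proof.
apply/seteqP; split=> x /=; rewrite /cyl /= size_rcons mkseqS.
  by move/rcons_inj => -[-> ->].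
by move=> [-> ->].
Qed.

Lemma cyl_nil : cyl [::] = setT.
Proof. by apply/seteqP; split. Qed.

Lemma open_cyl s : open (cyl s).
Proof.
elim/last_ind: s => [|s a IH]; first by rewrite cyl_nil; exact: openT.
by rewrite cyl_rcons; apply: openI => //; exact: (open_coord (size s) [set a]).
Qed.

Lemma seqsp_open_measurable (A : set (seqsp U)) : open A -> measurable A.
Proof. by move=> oA; exact: sub_sigma_algebra. Qed.

Lemma measurable_cyl s : measurable (cyl s).
Proof. by apply: seqsp_open_measurable; exact: open_cyl. Qed.

Lemma measurable_coord i (B : set U) : measurable [set x : seqsp U | B (x i)].
Proof. by apply: seqsp_open_measurable; exact: open_coord. Qed.

Definition cylinders : set (set (seqsp U)) := [set A | A = set0 \/ exists s, A = cyl s].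

Lemma cylinders0 : cylinders set0. Proof. exact: or_introl. Qed.

Lemma cylinders_cyl s : cylinders (cyl s).
Proof. by apply: or_intror; exists s. Qed.

(** An open set is the union of the cylinders that it contains, and there are
    countably many cylinders. *)
Lemma measurable_cylinders :
  (measurable : set (set (seqsp U))) = <<s cylinders >>.
Proof.
apply/seteqP; split.
  apply: smallest_sub; first exact: smallest_sigma_algebra.
  move=> A oA.
  pose F (o : option (seq U)) :=
    if o is Some s then if pselect (cyl s `<=` A) then cyl s else set0 else set0.
  have -> : A = \bigcup_n F (unpickle n).
    apply/seteqP; split=> [x Ax|x [n _]]; last first.
      by move: (unpickle n) => [s /=|//]; case: pselect => // sA /sA.
    have [n nA] := nbhs_agree (open_nbhs_nbhs (conj oA Ax)).
    exists (pickle (mkseq x n)) => //; rewrite pickleK /=.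
    have sA : cyl (mkseq x n) `<=` A.
      by move=> y; rewrite /cyl /= size_mkseq => /agree_mkseq; exact: nA.
    by case: pselect => [h|/(_ sA)//]; rewrite /cyl /= size_mkseq.
  apply: sigma_algebra_bigcup => n; apply: sub_sigma_algebra.
  move: (unpickle n) => [s /=|]; last exact: cylinders0.
  by case: pselect => ? /=; [exact: cylinders_cyl|exact: cylinders0].
apply: smallest_sub; first exact: sigma_algebra_measurable.
move=> _ [->|[s ->]]; [exact: measurable0|exact: measurable_cyl].
Qed.

Lemma cylindersI : setI_closed cylinders.
Proof.
suff key s s' : (size s <= size s')%N -> cyl s `&` cyl s' = cyl s' \/
    cyl s `&` cyl s' = set0.
  move=> _ _ [->|[s ->]] [->|[s' ->]]; rewrite ?set0I ?setI0; try exact: cylinders0.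
  have [/key[] ->|/ltnW/key] := leqP (size s) (size s').
  - exact: cylinders_cyl.
  - exact: cylinders0.
  - by rewrite setIC => -[->|->]; [exact: cylinders_cyl|exact: cylinders0].
move=> ss'; have [e|e] := pselect (take (size s) s' = s).
  left; apply/seteqP; split=> [x []//|x xs']; split=> //.
  rewrite /cyl /= -[RHS]e -[in RHS]xs' /mkseq -map_take.
  by rewrite take_iota (minn_idPl ss').
right; apply/seteqP; split=> [x [xs xs']|//]; apply: e.
by rewrite -[RHS]xs -[in LHS]xs' /mkseq -map_take take_iota (minn_idPl ss').
Qed.

Lemma measurable_fun_seqsp d (T : measurableType d) (f : T -> seqsp U) :
  (forall s, measurable (f @^-1` cyl s)) -> measurable_fun setT f.
Proof.
move=> mf; apply: (@measurability _ _ _ _ _ f (@cylinders)) => //;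
  first exact: measurable_cylinders.
move=> _ [_ [->|[s ->]] <-]; first by rewrite preimage_set0 setI0.
by rewrite setTI.
Qed.

Variable R : realType.

Lemma eq_measure_cyl (m1 m2 : {measure set (seqsp U) -> \bar R}) :
  (m1 setT < +oo)%E -> (forall s, m1 (cyl s) = m2 (cyl s)) ->
  forall A, measurable A -> m1 A = m2 A.
Proof.
move=> fin e A mA.
apply: (measure_unique cylinders (fun=> setT) measurable_cylinders cylindersI) => //.
- by move=> _; rewrite -cyl_nil; exact: cylinders_cyl.
- by rewrite bigcup_const //; exists 0%N.
- by move=> _ [->|[s ->]]; rewrite ?measure0.
Qed.

End cylinders.

(** * Measures with prescribed cylinder probabilities *)

Lemma image_probability d d' (T : measurableType d) (T' : measurableType d')
    (R : realType) (P : probability T R) (f : T -> T') :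
  measurable_fun setT f ->
  exists Q : probability T' R, forall A, Q A = P (f @^-1` A).
Proof.
move=> mf; pose X : {mfun T >-> T'} := HB.pack f (isMeasurableFun.Build _ _ _ _ f mf).
by exists (distribution P X).
Qed.

(** The measure is the law of a coding of a uniform point of the unit interval:
    the interval of a word is cut, in the order of the alphabet, into the
    intervals of its one-letter extensions, and a point is sent to the sequence
    whose prefixes have intervals containing it. Words are read from right to
    left, which makes extension by a letter the constructor of lists. *)
Section kolmogorov.
Variables (R : realType) (U : pfinType) (p : seq U -> R).
Hypothesis p_ge0 : forall s, 0 <= p s.
Hypothesis p_nil : p [::] = 1.
Hypothesis p_rcons : forall s, \sum_a p (rcons s a) = p s.

Let q (s : seq U) : R := p (rev s).

Let q_ge0 s : 0 <= q s. Proof. exact: p_ge0. Qed.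

Let q_cons s : \sum_a q (a :: s) = q s.
Proof. by rewrite /q -[RHS]p_rcons; apply: eq_bigr => a _; rewrite rev_cons. Qed.

Let rank (a : U) : nat := enum_rank a.

Let below (s : seq U) (j : nat) : R := \sum_(b | (rank b < j)%N) q (b :: s).

Fixpoint left_end (s : seq U) : R :=
  if s is a :: s' then left_end s' + below s' (rank a) else 0.

Let inI (s : seq U) (r : R) := left_end s <= r < left_end s + q s.

Let belowS s (a : U) : below s (rank a).+1 = below s (rank a) + q (a :: s).
Proof.
rewrite /below (bigD1 a) //= addrC; congr (_ + _); apply: eq_bigl => b.
rewrite ltnS leq_eqVlt andbC; have [->|ba] := eqVneq b a; first by rewrite ltnn.
by rewrite (negbTE (_ : rank b != rank a)) // /rank val_eqE (inj_eq enum_rank_inj).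
Qed.

Let below_mono s i j : (i <= j)%N -> below s i <= below s j.
Proof.
move=> ij; rewrite /below [leRHS](bigID (fun b => (rank b < i)%N)) /=.
rewrite [X in _ <= X + _](eq_bigl (fun b => (rank b < i)%N)).
  by rewrite lerDl sumr_ge0.
by move=> b; rewrite andbC; case: ltnP => //= bi; rewrite (leq_trans bi).
Qed.

Let below_card s : below s #|U| = q s.
Proof. by rewrite -q_cons; apply: eq_bigl => b; rewrite ltn_ord. Qed.

Let inI_cons s a r : inI (a :: s) r -> inI s r.
Proof.
move=> /andP[/= h1 h2]; apply/andP; split.
  by apply: le_trans h1; rewrite lerDl /below sumr_ge0.
apply: (lt_le_trans h2); rewrite -addrA -belowS lerD2l -below_card.
by apply: below_mono; rewrite ltn_ord.
Qed.

Let inI_next s r : inI s r -> exists a, inI (a :: s) r.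
Proof.
move=> /andP[h1 h2].
have key J : r < left_end s + below s J ->
    exists2 j, (j < J)%N & left_end s + below s j <= r < left_end s + below s j.+1.
  elim: J => [|J IH] hJ.
    by move: hJ; rewrite /below big_pred0 // addr0 ltNge h1.
  have [/IH[j jJ hj]|hJ'] := ltP r (left_end s + below s J).
    by exists j => //; rewrite ltnS ltnW.
  by exists J => //; rewrite hJ'.
have := key #|U|; rewrite below_card => /(_ h2) [j jU hj].
exists (enum_val (Ordinal jU)).
rewrite /inI /= -addrA -belowS.
by rewrite (_ : rank _ = j) // /rank enum_valK.
Qed.

Let inI_uniq s a b r : inI (a :: s) r -> inI (b :: s) r -> a = b.
Proof.
have key a' b' : inI (a' :: s) r -> inI (b' :: s) r -> (rank b' <= rank a')%N.
  move=> /andP[_ ha] /andP[hb _]; rewrite leqNgt; apply/negP => lt.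
  move: (le_lt_trans hb ha); rewrite /= -addrA -belowS ltrD2l ltNge.
  by rewrite below_mono.
move=> ha hb; apply/enum_rank_inj/val_inj/eqP.
by rewrite eqn_leq /= (key _ _ hb ha) (key _ _ ha hb).
Qed.

Let next s r : U := odflt point [pick a | inI (a :: s) r].

Let nextP s r : inI s r -> inI (next s r :: s) r.
Proof.
move=> /inI_next[a ha]; rewrite /next; case: pickP => //= /(_ a).
by rewrite ha.
Qed.

Fixpoint coding_prefix (r : R) (n : nat) : seq U :=
  if n is n'.+1 then next (coding_prefix r n') r :: coding_prefix r n' else [::].

Let coding (r : R) : seqsp U := fun n => next (coding_prefix r n) r.

Let rev_coding_prefix r n : rev (coding_prefix r n) = mkseq (coding r) n.
Proof. by elim: n => // n IH; rewrite mkseqS -IH /= rev_cons. Qed.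

Let inI_nil r : inI [::] r = (0 <= r < 1).
Proof. by rewrite /inI /= add0r /q p_nil. Qed.

Let inI_coding_prefix r n : 0 <= r < 1 -> inI (coding_prefix r n) r.
Proof. by move=> r01; elim: n => [|n IH]; rewrite ?inI_nil //; exact: nextP. Qed.

Let coding_prefix_uniq r s : inI s r -> coding_prefix r (size s) = s.
Proof.
elim: s => //= a s IH has; have hs := inI_cons has; rewrite IH //.
by congr (_ :: _); apply: inI_uniq has; exact: nextP.
Qed.

Let D : set R := `[0, 1[%classic.

Let mD : measurable D. Proof. exact: measurable_itv. Qed.

Let phi (r : R) : seqsp U := if 0 <= r < 1 then coding r else point.

Let phi_cyl s : phi @^-1` cyl s `&` D =
  `[left_end (rev s), left_end (rev s) + p s[%classic.
Proof.
have eI r : (r \in `[left_end (rev s), left_end (rev s) + p s[) = inI (rev s) r.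
  by rewrite in_itv /= /inI /q revK.
apply/seteqP; split=> r.
  move=> [h]; rewrite {1}/D /= in_itv /= => r01; rewrite /= eI.
  move: h; rewrite /= /phi r01 /cyl /= => h.
  by rewrite -[in rev s]h -rev_coding_prefix revK; exact: inI_coding_prefix.
rewrite /= eI => h.
have r01 : 0 <= r < 1.
  by rewrite -inI_nil; elim: (rev s) h => // a s' IH /inI_cons/IH.
split; last by rewrite /D /= in_itv.
rewrite /= /phi r01 /cyl /= -rev_coding_prefix.
by have := coding_prefix_uniq h; rewrite size_rev => ->; rewrite revK.
Qed.

Let measurable_phi : measurable_fun setT phi.
Proof.
apply: measurable_fun_seqsp => s.
have -> : phi @^-1` cyl s = (phi @^-1` cyl s `&` D) `|`
    (~` D `&` (if pselect (cyl s (point : seqsp U)) then setT else set0)).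
  rewrite -[LHS](setIT _) -[in LHS](setUv D) setIUr; congr (_ `|` _).
  have notD r : ~ D r -> (0 <= r < 1) = false.
    by move=> rD; apply/negP => r01; apply: rD; rewrite /D /= in_itv.
  apply/seteqP; split=> r.
    move=> [h rD]; split=> //; move: h; rewrite /= /phi (notD r rD).
    by case: pselect.
  by move=> [rD h]; split=> //; move: h; rewrite /= /phi (notD r rD); case: pselect.
apply: measurableU; first by rewrite phi_cyl; exact: measurable_itv.
apply: measurableI; first exact: measurableC.
by case: pselect => ? /=; [exact: measurableT|exact: measurable0].
Qed.

Lemma cylinder_extension :
  exists P : probability (seqsp U) R, forall s, P (cyl s) = (p s)%:E.
Proof.
pose L : {measure set (measurableTypeR R) -> \bar R} := mrestr (@lebesgue_measure R) mD.
have L1 : L setT = 1%E.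
  by rewrite /L /= /mrestr setTI lebesgue_measure_itv /= lte_fin ltr01 oppr0 addr0.
pose P0 : probability (measurableTypeR R) R := mnormalize L point.
have P0E A : P0 A = L A.
  by rewrite /P0 /= /mnormalize L1 onee_eq0 /= invr1 mule1.
have [Q QE] := image_probability P0 measurable_phi.
exists Q => s; rewrite QE P0E /L /= /mrestr phi_cyl lebesgue_measure_itv /= lte_fin.
rewrite ltrDl lt_neqAle p_ge0 andbT; case: eqVneq => [<-//|_ /=].
by rewrite -EFinD addrAC subrr add0r.
Qed.

End kolmogorov.

(** * Prefixes and block laws *)

Section prefixes.
Variables (R : realType) (U : pfinType).

Definition prefix k (x : seqsp U) : block k U := [ffun i : 'I_k => x i].

Lemma cyl_codom k (u : block k U) : cyl (codom u) = [set x | prefix k x = u].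
Proof.
apply/seteqP; split=> x.
  move=> /cylP h; apply/ffunP => i; rewrite ffunE h ?nth_codom_ord//.
  by rewrite size_codom card_ord.
move=> /= <-; apply/cylP => i; rewrite size_codom card_ord => ik.
by rewrite (nth_codom_ord _ _ (Ordinal ik)) ffunE.
Qed.

Lemma cyl_prefix k (u : block k U) :
  [set x : seqsp U | forall i : 'I_k, x i = u i] = cyl (codom u).
Proof.
rewrite cyl_codom; apply/seteqP; split=> x /= h.
  by apply/ffunP => i; rewrite ffunE.
by move=> i; rewrite -h ffunE.
Qed.

Lemma measurable_prefix k (S : pred (block k U)) :
  measurable [set x | S (prefix k x)].
Proof.
have -> : [set x | S (prefix k x)] = \bigcup_(u in [set u | S u]) cyl (codom u).
  apply/seteqP; split=> [x /= Sx|x [u /= Su]]; rewrite ?cyl_codom.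
    by exists (prefix k x) => //; rewrite cyl_codom.
  by move=> /= ->.
by apply: fin_bigcup_measurable => // u _; exact: measurable_cyl.
Qed.

Lemma measure_fibers (m : {measure set (seqsp U) -> \bar R}) (A : set (seqsp U))
    (B : finType) (f : seqsp U -> B) (S : pred B) :
  measurable A -> (forall b, measurable (f @^-1` [set b])) ->
  m (A `&` [set x | S (f x)]) = (\sum_(b | S b) m (A `&` f @^-1` [set b]))%E.
Proof.
move=> mA mf; rewrite -big_filter; set s := [seq b <- _ | _].
have us : uniq s by rewrite filter_uniq // index_enum_uniq.
have -> : [set x | S (f x)] = [set x | f x \in s].
  by apply/seteqP; split=> x /=; rewrite mem_filter mem_index_enum andbT.
have ms (s' : seq B) : measurable [set x | f x \in s'].
  elim: s' => [|b s' IH].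
    by rewrite (_ : [set x | _] = set0) //; apply/seteqP; split.
  rewrite (_ : [set x | _] = f @^-1` [set b] `|` [set x | f x \in s']).
    exact: measurableU.
  apply/seteqP; split=> x /=; rewrite inE; first by move=> /orP[/eqP|]; [left|right].
  by move=> [->|->]; rewrite ?eqxx ?orbT.
elim: s us => [_|b s IH /= /andP[bs /IH {}IH]].
  by rewrite big_nil (_ : _ `&` _ = set0) ?measure0 //; apply/seteqP; split=> // x [].
rewrite big_cons -IH -measureU; [|exact: measurableI..|].
- congr (m _); rewrite -setIUr; congr (_ `&` _); apply/seteqP; split=> x /=.
    by rewrite inE => /orP[/eqP|]; [left|right].
  by rewrite inE => -[->|->]; rewrite ?eqxx ?orbT.
- apply/seteqP; split=> // x [[_ /= ->] [_ /=]].
  by rewrite (negbTE bs).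
Qed.

Lemma measure_prefix k (m : {measure set (seqsp U) -> \bar R})
    (S : pred (block k U)) :
  m [set x | S (prefix k x)] = (\sum_(u | S u) m (cyl (codom u)))%E.
Proof.
rewrite -[X in m X]setTI measure_fibers //.
  by apply: eq_bigr => u _; rewrite setTI cyl_codom.
by move=> u; have := measurable_cyl (codom u); rewrite cyl_codom.
Qed.

Variable P : probability (seqsp U) R.

Lemma block_lawE k (u : block k U) : P (cyl (codom u)) = (block_law P u)%:E.
Proof.
have -> : block_law P u = fine (P (cyl (codom u))) by rewrite -cyl_prefix.
rewrite fineK // fin_num_measure //; exact: measurable_cyl.
Qed.

Lemma prob_prefix k (S : pred (block k U)) :
  P [set x | S (prefix k x)] = (\sum_(u | S u) block_law P u)%:E.
Proof.
by rewrite measure_prefix -sumEFin; apply: eq_bigr => u _; exact: block_lawE.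
Qed.

Lemma block_law_ge0 k (u : block k U) : 0 <= block_law P u.
Proof. by rewrite -lee_fin -block_lawE. Qed.

Lemma block_law_pmf k : is_pmf (@block_law R U k P).
Proof.
split; first exact: block_law_ge0.
apply: EFin_inj; rewrite -(prob_prefix xpredT) -(@probability_setT _ _ _ P).
by congr (P _); apply/seteqP; split.
Qed.

Lemma prob_shift_cyl k l s : (l + size s <= k)%N ->
  P (@Defs.shift U l @^-1` cyl s) =
  (\sum_(u : block k U | mkseq (fun i => cyc u (l + i)) (size s) == s)
      block_law P u)%:E.
Proof.
move=> lk; rewrite -prob_prefix; congr (P _).
have e x : mkseq (fun i => cyc (prefix k x) (l + i)) (size s) =
    mkseq (Defs.shift l x) (size s).
  apply: (@eq_from_nth _ point); rewrite ?size_mkseq // => i im.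
  have ik : (l + i < k)%N by apply: leq_trans lk; rewrite ltn_add2l.
  rewrite !nth_mkseq // (_ : (l + i)%N = Ordinal ik) // cyc_ord ffunE.
  by [].
by apply/seteqP; split=> x /=; rewrite e => /eqP.
Qed.

Hypothesis P_stat : shift_invariant P.

Lemma shift_invariant_iter l A : measurable A -> P (@Defs.shift U l @^-1` A) = P A.
Proof.
elim: l A => [|l IH] A mA.
  by congr (P _); apply/seteqP; split=> x.
have mS : measurable (@Defs.shift U l @^-1` A).
  by rewrite -[X in measurable X]setTI; exact: Defs.measurable_shift.
by rewrite -(IH A mA) -(P_stat mS).
Qed.

Lemma block_law_window k l s : (l + size s <= k)%N ->
  (\sum_(u : block k U | mkseq (fun i => cyc u (l + i)) (size s) == s)
      block_law P u)%:E = P (cyl s).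
Proof.
by move=> lk; rewrite -prob_shift_cyl // shift_invariant_iter //; exact: measurable_cyl.
Qed.

End prefixes.

(** * Block-independent measures *)

Section iid_blocks.
Variables (R : realType) (U : pfinType) (k : nat) (g : block k U -> R).
Hypotheses (k_gt0 : (0 < k)%N) (g_pmf : is_pmf g).

(** The independent sequence of blocks lives on the alphabet of blocks, where it
    is a product measure; concatenating its letters gives the required measure. *)
Lemma blocks_iid_exists : exists P : probability (seqsp U) R, blocks_iid g P.
Proof.
pose V : pfinType := HB.pack (block k U) (isPointed.Build _ [ffun=> point]).
pose p (s : seq V) : R := \prod_(w <- s) g w.
have [Q QE] : exists Q : probability (seqsp V) R, forall s, Q (cyl s) = (p s)%:E.
  apply: cylinder_extension.
  - by move=> s; apply: prodr_ge0 => w _; exact: g_pmf.1.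
  - by rewrite /p big_nil.
  - move=> s.
    have e w : p (rcons s w) = p s * g w by rewrite /p -cats1 big_cat big_seq1.
    by under eq_bigr do rewrite e; rewrite -mulr_sumr g_pmf.2 mulr1.
pose concat (z : seqsp V) : seqsp U := fun i => cyc (z (i %/ k)%N : block k U) i.
have mconcat : measurable_fun setT concat.
  apply: measurable_fun_seqsp; elim/last_ind => [|s a IH].
    by rewrite cyl_nil preimage_setT; exact: measurableT.
  rewrite cyl_rcons preimage_setI; apply: measurableI => //.
  exact: (@measurable_coord V (size s %/ k)
    [set w : V | cyc (w : block k U) (size s) = a]).
have [P PE] := image_probability Q mconcat.
exists P => m w; rewrite PE.
have -> : concat @^-1` [set x | forall (j : 'I_m) (i : 'I_k), x (j * k + i)%N = w j i]
    = cyl (codom (w : 'I_m -> V)).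
  have cE z (j : 'I_m) (i : 'I_k) : concat z (j * k + i)%N = (z j : block k U) i.
    rewrite /concat divnMDl // divn_small // addn0 -cyc_modn modnMDl cyc_modn.
    exact: cyc_ord.
  apply/seteqP; split=> z /=.
    move=> h; apply/cylP => j; rewrite size_codom card_ord => jm.
    rewrite (nth_codom_ord _ _ (Ordinal jm)); apply/ffunP => i.
    by rewrite -h cE.
  move=> /cylP h j i; rewrite cE h ?size_codom ?card_ord //.
  by rewrite (nth_codom_ord _ (w : 'I_m -> V)).
rewrite QE /p /codom big_map big_enum /=.
by congr (_%:E); apply: eq_bigr.
Qed.

Lemma iid_block_measureP : blocks_iid g (iid_block_measure g).
Proof.
have [P hP] := blocks_iid_exists.
exact: (@xgetI _ point [set P | blocks_iid g P] P hP).
Qed.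

Lemma block_law_iid u : block_law (iid_block_measure g) u = g u.
Proof.
have := iid_block_measureP (fun _ : 'I_1 => u); rewrite big_ord1.
move=> h; apply: EFin_inj; rewrite -h -block_lawE; congr (iid_block_measure g _).
rewrite -cyl_prefix; apply/seteqP; split=> x /=.
  by move=> e j i; rewrite (ord1 j) mul0n add0n e.
by move=> e i; have := e ord0 i; rewrite mul0n add0n.
Qed.

Lemma randomized_block_measureE A :
  randomized_block_measure g A =
  (k%:R^-1%:E * \sum_(l < k) iid_block_measure g (@Defs.shift U l @^-1` A))%E.
Proof. by []. Qed.

(** Windows that fit in a block have the same law in both measures, and at most
    [size s] of the [k] positions of a window do not fit. *)
Lemma randomized_block_measure_cyl s :
  exists2 r : R, randomized_block_measure g (cyl s) = r%:E &
    `|r - cyclic_words g s| <= (size s)%:R / k%:R.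
Proof.
pose P := iid_block_measure g.
pose a l := fine (P (@Defs.shift U l @^-1` cyl s)).
have mS l : measurable (@Defs.shift U l @^-1` cyl s).
  rewrite -[X in measurable X]setTI; apply: Defs.measurable_shift => //.
  exact: measurable_cyl.
have aE l : P (@Defs.shift U l @^-1` cyl s) = (a l)%:E.
  by rewrite fineK // fin_num_measure.
have a01 l : 0 <= a l <= 1.
  by rewrite -!lee_fin -aE measure_ge0 probability_le1.
pose b l := \sum_(u | mkseq (fun i => cyc u (l + i)) (size s) == s) g u.
have b01 l : 0 <= b l <= 1.
  rewrite sumr_ge0 /=; last by move=> u _; exact: g_pmf.1.
  rewrite -g_pmf.2 /b.
  rewrite [leRHS](bigID (fun u => mkseq (fun i => cyc u (l + i)) (size s) == s)) /=.
  by rewrite lerDl sumr_ge0 // => u _; exact: g_pmf.1.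
exists (k%:R^-1 * \sum_(l < k) a l).
  rewrite randomized_block_measureE EFinM; congr (_ * _)%E.
  by rewrite -sumEFin; apply: eq_bigr => l _; rewrite -aE.
have -> : cyclic_words g s = k%:R^-1 * \sum_(l < k) b l by rewrite mulr_sumr.
rewrite -mulrBr -sumrB normrM ger0_norm ?invr_ge0 ?ler0n // mulrC.
rewrite ler_wpM2r ?invr_ge0 ?ler0n //.
apply: (le_trans (ler_norm_sum _ _ _)).
have step l : `|a l - b l| <= ((k < l + size s)%N)%:R.
  have [lk|lk] := ltnP k (l + size s) => /=.
    by rewrite ler_norml; move: (a01 l) (b01 l) => /andP[? ?] /andP[? ?]; lra.
  rewrite (_ : a l = b l) ?subrr ?normr0 //.
  by rewrite /a (prob_shift_cyl P lk) /=; apply: eq_bigr => u _; exact: block_law_iid.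
apply: (@le_trans _ _ (\sum_(l < k) ((k < l + size s)%N)%:R)).
  by apply: ler_sum => l _; exact: step.
by rewrite -natr_sum ler_nat overlap_count.
Qed.

Lemma randomized_block_measureT : randomized_block_measure g setT = 1%E.
Proof.
rewrite randomized_block_measureE.
under eq_bigr => l _ do rewrite preimage_setT probability_setT.
rewrite sumEFin -EFinM sumr_const card_ord.
by rewrite -[X in _ * X]mulr_natr mul1r mulVf // pnatr_eq0 -lt0n.
Qed.

End iid_blocks.

(** * Compactness and weak convergence *)

Lemma homo_ltn_ge (t : nat -> nat) :
  {homo t : m n / (m < n)%N} -> forall n, (n <= t n)%N.
Proof.
by move=> ht; elim=> // n IH; rewrite (leq_ltn_trans IH) // ht.
Qed.

Lemma cvgn_subseq (T : topologicalType) (u : nat -> T) (l : T) (t : nat -> nat) :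
  {homo t : m n / (m < n)%N} -> u @ \oo --> l -> u (t n) @[n --> \oo] --> l.
Proof.
move=> ht ul A /ul [N _ hN]; exists N => // n /= Nn; apply: hN => /=.
exact: leq_trans (homo_ltn_ge ht n).
Qed.

(** A cluster point exists by the theorem of Tychonoff; a subsequence that
    converges to it is found because finitely many coordinates at a time have to
    be controlled. *)
Lemma bounded_family_subseq (R : realType) (I : countType) (a : nat -> I -> R) :
  (forall n i, 0 <= a n i <= 1) ->
  exists t : nat -> nat, {homo t : m n / (m < n)%N} /\
    exists l : I -> R, forall i, a (t n) i @[n --> \oo] --> l i.
Proof.
move=> a01.
pose T := prod_topology (fun _ : I => (R : topologicalType)).
pose C : set T := [set f | forall i : I, `[0, 1]%classic (f i)].
have cC : compact C.
  apply: (@tychonoff I (fun=> (R : topologicalType)) (fun=> `[0, 1]%classic)) => i.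
  exact: segment_compact.
have PF : ProperFilter ((a : nat -> T) @ \oo) by exact: fmap_proper_filter.
have [l [_ cl]] : C `&` cluster ((a : nat -> T) @ \oo) !=set0.
  by apply: (cC _ PF); exists 0%N => // n _ i; rewrite /= in_itv /=; exact: a01.
(* the [V j] form a countable basis of neighbourhoods of [l] *)
pose V j := [set f : T | forall i : I, (pickle i <= j)%N -> `|l i - f i| < j.+1%:R^-1].
have nV j : nbhs (l : T) (V j).
  have nW i : nbhs (l : T) [set f : T | `|l i - f i| < j.+1%:R^-1].
    have := @proj_continuous I (fun=> (R : topologicalType)) i l.
    move=> /(_ (ball (l i) j.+1%:R^-1)); apply.
    by apply: nbhsx_ballx; rewrite invr_gt0.
  have : forall m, nbhs (l : T) [set f : T | forall i : I, (pickle i < m)%N ->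
      `|l i - f i| < j.+1%:R^-1].
    elim=> [|m IH]; first by apply: filterE.
    case e : (@unpickle I m) => [i|]; last first.
      apply: filterS IH => f hf i; rewrite ltnS leq_eqVlt => /orP[/eqP im|]; last exact: hf.
      by move: e; rewrite -im pickleK.
    apply: filterS (filterI IH (nW i)) => f [hf hi] i'.
    rewrite ltnS leq_eqVlt => /orP[/eqP im|]; last exact: hf.
    by move: e; rewrite -im pickleK => -[->].
  by move=> /(_ j.+1).
have /choice[f hf] : forall Nj : nat * nat, exists n, (Nj.1 <= n)%N /\ V Nj.2 (a n).
  move=> [N j] /=.
  have [_ [[n Nn <-] Vn]] : ((a : nat -> T) @` [set n | (N <= n)%N]) `&` V j !=set0.
    apply: cl => //; exists N => // n Nn; by exists n.
  by exists n.
pose t := fix t j := if j is j'.+1 then f ((t j').+1, j) else f (0%N, 0%N).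
have Vt j : V j (a (t j)).
  by case: j => [|j]; [exact: (hf (0, 0)%N).2|exact: (hf ((t j).+1, j.+1)).2].
exists t; split.
  by apply: homo_ltn => [m n p|i]; [exact: ltn_trans|exact: (hf ((t i).+1, i.+1)).1].
exists l => i; apply/cvgrPdist_lt => e e0.
near=> n; apply: (@lt_le_trans _ _ n.+1%:R^-1).
  by apply: Vt; near: n; exists (pickle i).
rewrite -[e]invrK lef_pV2 ?posrE ?invr_gt0 ?ltr0n //.
apply: (le_trans (ltW (truncnS_gt e^-1))); rewrite ler_nat ltnS.
by near: n; exists (Num.trunc e^-1).
Unshelve. all: by end_near.
Qed.

Section weak_convergence.
Variables (R : realType) (U : pfinType).
Implicit Types f : seqsp U -> R.

(** Uniform continuity, by the argument of König: if the oscillation of [f] is not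
    uniformly small on a cylinder, the same holds on the cylinder of some one-letter
    extension, and continuity fails at the sequence obtained in this way. *)
Lemma continuous_uniform f (e : R) : continuous f -> 0 < e ->
  exists m, forall x y : seqsp U, agree m x y -> `|f x - f y| <= e.
Proof.
move=> fc e0.
pose good (s : seq U) := exists m, forall x y, cyl s x -> cyl s y ->
  agree m x y -> `|f x - f y| <= e.
have [[m hm]|bad0] := pselect (good [::]).
  by exists m => x y; apply: hm; rewrite cyl_nil.
have step s : ~ good s -> exists a, ~ good (rcons s a).
  move=> bs; apply: contrapT => /forallNP h; apply: bs.
  have /choice[M hM] : forall a, exists m, forall x y, cyl (rcons s a) x ->
      cyl (rcons s a) y -> agree m x y -> `|f x - f y| <= e.
    by move=> a; have /contrapT := h a.
  exists (maxn (size s).+1 (\max_a M a)) => x y sx sy xy.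
  have xs : y (size s) = x (size s) by apply: xy; rewrite leq_max leqnn.
  apply: (hM (x (size s))); [by rewrite cyl_rcons; split..|].
  move=> i im; apply: xy; apply: (leq_trans im).
  by rewrite leq_max (@leq_bigmax U M (x (size s))) orbT.
have /choice[nx hnx] : forall s, exists a, ~ good s -> ~ good (rcons s a).
  move=> s; have [gs|/step[a ha]] := pselect (good s); last by exists a.
  by exists point.
pose w := fix w n := if n is n'.+1 then rcons (w n') (nx (w n')) else [::].
have wbad n : ~ good (w n) by elim: n => // n; exact: hnx.
pose x : seqsp U := fun n => nx (w n).
have wE n : w n = mkseq x n by elim: n => // n IH; rewrite mkseqS -IH.
have [N hN] : exists n, agree n x `<=` [set y | `|f x - f y| < e / 2].
  apply: nbhs_agree; have /cvgrPdist_lt/(_ (e / 2)) := fc x; apply.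
  by rewrite divr_gt0.
exfalso; apply: (wbad N); exists 0%N => y z; rewrite wE /cyl /= size_mkseq.
move=> /agree_mkseq/hN/= hy /agree_mkseq/hN/= hz _.
rewrite (_ : f y - f z = (f x - f z) - (f x - f y)); last by ring.
rewrite (le_trans (ler_normB _ _)) //; move: hy hz; lra.
Qed.

Definition extend m (u : block m U) : seqsp U := nth point (codom u).

Lemma agree_extend m (x : seqsp U) : agree m x (extend (prefix m x)).
Proof.
by move=> i im; rewrite /extend (nth_codom_ord _ _ (Ordinal im)) ffunE.
Qed.

Lemma continuous_seqsp_measurable f : continuous f -> measurable_fun setT f.
Proof.
move=> /continuousP cf.
apply: (measurability _ (measurable_realfun.RGenOpens.measurableE R)).
move=> _ [_ [a [b ->] <-]]; rewrite setTI; apply: seqsp_open_measurable.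
by apply: cf; exact: interval_open.
Qed.

Lemma continuous_integrable f (P : probability (seqsp U) R) :
  continuous f -> bounded_fun f -> P.-integrable setT (EFin \o f).
Proof.
move=> fc fb; apply: measurable_bounded_integrable => //.
- by rewrite (le_lt_trans (probability_le1 P measurableT)) ?ltry.
- exact: continuous_seqsp_measurable.
Qed.

(** The approximating linear combination of masses of cylinders does not depend on
    [P], so that convergence on cylinders implies weak convergence. *)
Lemma integral_cyl_approx f m (e : R) (P : probability (seqsp U) R) :
  continuous f -> bounded_fun f ->
  (forall x y : seqsp U, agree m x y -> `|f x - f y| <= e) ->
  (`|\int[P]_z (f z)%:E -
    (\sum_(u : block m U) f (extend u) * fine (P (cyl (codom u))))%:E| <= e%:E)%E.
Proof.
move=> fc fb hm.
have Pfin A : measurable A -> P A \is a fin_num by move=> mA; rewrite fin_num_measure.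
have fi : P.-integrable setT (EFin \o f).
  exact: continuous_integrable.
pose g (u : block m U) (x : seqsp U) : R := f (extend u) * \1_(cyl (codom u)) x.
have ii u : P.-integrable setT (fun x => (\1_(cyl (codom u)) x)%:E).
  by apply: integrable_indic; exact: measurable_cyl.
have gi u : P.-integrable setT (EFin \o g u).
  have -> : EFin \o g u = (fun x => (f (extend u))%:E * (\1_(cyl (codom u)) x)%:E)%E.
    by apply/funext => x; rewrite /= -EFinM.
  exact: integrableZl.
pose fm x := f (extend (prefix m x)).
have fmE x : (\sum_u (g u x)%:E = (fm x)%:E)%E.
  rewrite sumEFin (bigD1 (prefix m x)) //= big1 ?addr0.
    by rewrite /g indicE cyl_codom mem_set //= mulr1.
  move=> u ux; rewrite /g indicE cyl_codom memNset ?mulr0 //= => h.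
  by rewrite h eqxx in ux.
have fmi : P.-integrable setT (EFin \o fm).
  have -> : EFin \o fm = (fun x => \sum_u (g u x)%:E)%E.
    by apply/funext => x; rewrite fmE.
  by apply: integrable_sum => // u _; exact: gi.
have -> : (\sum_(u : block m U) f (extend u) * fine (P (cyl (codom u))))%:E =
    (\int[P]_x (fm x)%:E)%E.
  under [RHS]eq_integral do rewrite -fmE.
  rewrite integral_sum // -sumEFin; apply: eq_bigr => u _.
  rewrite /g; under eq_integral do rewrite EFinM.
  rewrite integralZl // integral_indic ?setIT //; last exact: measurable_cyl.
  by rewrite EFinM fineK // Pfin //; exact: measurable_cyl.
rewrite -integralB_EFin //.
have md := measurable_int _ (integrableB measurableT fi fmi).
apply: (le_trans (le_abse_integral _ measurableT md)).
have P1 : (P : {measure set (seqsp U) -> \bar R}) setT = 1%E.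
  exact: probability_setT.
rewrite -[leRHS]mule1 -P1; apply: integral_le_bound => //.
- by rewrite lee_fin (le_trans _ (hm point point _)).
- apply: aeW => x _; rewrite -EFinB abse_EFin lee_fin; apply: hm; exact: agree_extend.
Qed.

Lemma weak_cvg_cyl (gam : nat -> {measure set (seqsp U) -> \bar R})
    (P : probability (seqsp U) R) :
  (forall n, gam n setT = 1%E) ->
  (forall s, gam n (cyl s) @[n --> \oo] --> P (cyl s)) ->
  weak_cvg gam P.
Proof.
move=> gam1 gamP f fc fb.
pose Q n : probability (seqsp U) R := mnormalize (gam n) point.
have QE n A : Q n A = gam n A.
  by rewrite /Q /= /mnormalize gam1 onee_eq0 /= invr1 mule1.
have intE n : (\int[gam n]_z (f z)%:E = \int[Q n]_z (f z)%:E)%E.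
  by apply: eq_measure_integral => A _ _; exact/esym/QE.
have fin (Q' : probability (seqsp U) R) : (\int[Q']_z (f z)%:E)%E \is a fin_num.
  apply: integrable_fin_num => //.
  exact: continuous_integrable.
under eq_fun do rewrite intE.
rewrite -(fineK (fin P)).
apply/fine_cvgP; split; first by apply: nearW => n; exact: fin.
apply/cvgrPdist_le => e e0.
have e3 : 0 < e / 3 by rewrite divr_gt0.
have [m hm] := continuous_uniform fc e3.
have approx (Q' : probability (seqsp U) R) := integral_cyl_approx Q' fc fb hm.
pose S (Q' : probability (seqsp U) R) :=
  \sum_(u : block m U) f (extend u) * fine (Q' (cyl (codom u))).
have SE (Q' : probability (seqsp U) R) :
    `|fine (\int[Q']_z (f z)%:E)%E - S Q'| <= e / 3.
  by have := approx Q'; rewrite -[X in (`|X - _|)%E]fineK ?fin // -EFinB abse_EFin lee_fin.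
have SQ : S (Q n) @[n --> \oo] --> S P.
  apply: cvg_sumr => u _; apply: cvgMr.
  apply: fine_cvg; rewrite fineK; last by rewrite fin_num_measure //; exact: measurable_cyl.
  by under eq_fun do rewrite QE; exact: gamP.
have /cvgrPdist_le/(_ _ e3) := SQ; apply: filterS => n hn.
have h1 := SE (Q n); have h2 := SE P; move: hn h1 h2.
rewrite /= !ler_norml => /andP[? ?] /andP[? ?] /andP[? ?].
by apply/andP; split; lra.
Qed.

End weak_convergence.

(** * Almost sure lower bound on empirical frequencies *)

Section ergodic_frequencies.
Variables (R : realType) (U : pfinType) (mu : probability (seqsp U) R).
Hypothesis mu_stat : shift_invariant mu.

Local Notation T := (@Defs.shift U 1).

Lemma measurable_gt (f : seqsp U -> R) (K : R) :
  measurable_fun setT f -> measurable [set x | K < f x].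
Proof.
move=> mf; have -> : [set x | K < f x] = setT `&` f @^-1` `]K, +oo[%classic.
  by apply/seteqP; split=> x; rewrite /= in_itv /= andbT; [split|case].
by apply: mf => //; exact: measurable_itv.
Qed.

Section maximal_inequality.
Variables (C : set (seqsp U)) (a : R).
Hypotheses (mC : measurable C) (a_ge0 : 0 <= a).

Let g (x : seqsp U) : R := a - \1_C x.

(** [excess n x] is the maximum of zero and of the first [n] partial sums of [g]
    along the orbit of [x]. *)
Fixpoint excess n (x : seqsp U) : R :=
  if n is n'.+1 then Num.max 0 (g x + excess n' (T x)) else 0.

Lemma excess_ge0 n x : 0 <= excess n x.
Proof. by case: n => //= n; rewrite le_max lexx. Qed.

Lemma excess_le n x : excess n x <= n%:R * a.
Proof.
elim: n x => [x|n IH x] /=; first by rewrite mul0r.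
rewrite ge_max mulr_ge0 ?ler0n //= -natr1 mulrDl mul1r addrC lerD //.
by rewrite /g lerBlDr lerDl indicE.
Qed.

Lemma excessS n x : excess n x <= excess n.+1 x.
Proof.
elim: n x => [x|n IH x] /=; first by rewrite le_max lexx.
have := IH (T x); rewrite /= => h.
by rewrite ge_max !le_max lexx /=; apply/orP; right; rewrite lerD2l.
Qed.

Lemma excess_homo n n' x : (n <= n')%N -> excess n x <= excess n' x.
Proof.
move=> /subnKC <-; elim: (n' - n)%N => [|d IH]; first by rewrite addn0.
by rewrite addnS (le_trans IH) // excessS.
Qed.

Lemma measurable_excess n : measurable_fun setT (excess n).
Proof.
elim: n => [|n IH] /=; first exact: measurable_cst.
apply: measurable_maxr => //.
apply: measurable_funD; last first.
  by apply: measurableT_comp IH _; exact: Defs.measurable_shift.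
by apply: measurable_funB => //; exact: measurable_indic.
Qed.

Definition excess_set n : set (seqsp U) := [set x | 0 < excess n.+1 x].

Lemma measurable_excess_set n : measurable (excess_set n).
Proof. exact: measurable_gt (measurable_excess n.+1). Qed.

Lemma integral_excess_shift n :
  (\int[mu]_x (excess n (T x))%:E = \int[mu]_x (excess n x)%:E)%E.
Proof.
have mE : measurable_fun setT (EFin \o excess n).
  by apply/measurable_EFinP; exact: measurable_excess.
rewrite -[LHS](ge0_integral_distribution T mE); last first.
  by move=> x; rewrite lee_fin excess_ge0.
by apply: eq_measure_integral => A mA _; exact/mu_stat.
Qed.

(** The maximal ergodic inequality, in the form due to Garsia. Where the excess is
    positive it equals [g] plus the previous excess at the shifted point, elsewhere
    it vanishes; integration against an invariant measure cancels the excess. *)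
Lemma maximal_inequality n : (mu (C `&` excess_set n) <= a%:E * mu (excess_set n))%E.
Proof.
have mS := measurable_excess_set n; have mCS := measurableI _ _ mC mS.
set E := excess_set n in mS mCS *.
have mex k : measurable_fun setT (EFin \o excess k).
  by apply/measurable_EFinP; exact: measurable_excess.
have mexT k : measurable_fun setT (fun x => (excess k (T x))%:E).
  by apply: (measurableT_comp (mex k)); exact: Defs.measurable_shift.
have mI (A : set (seqsp U)) : measurable A ->
    measurable_fun setT (fun x => (\1_A x)%:E : \bar R).
  by move=> mA; apply/measurable_EFinP; exact: measurable_indic.
have maI : measurable_fun setT (fun x => a%:E * (\1_E x)%:E : \bar R)%E.
  by apply: measurable_funeM; exact: mI.
have key : (\int[mu]_x ((\1_(C `&` E) x)%:E + (excess n.+1 x)%:E) <=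
    \int[mu]_x (a%:E * (\1_E x)%:E + (excess n.+1 (T x))%:E))%E.
  apply: ge0_le_integral => //.
  - by move=> x _; rewrite -EFinD lee_fin addr_ge0 // excess_ge0.
  - by apply: emeasurable_funD; [exact: mI|exact: mex].
  - by apply: emeasurable_funD.
  - move=> x _; rewrite -EFinM -!EFinD lee_fin !indicE.
    have [xE|xE] := pselect (E x).
      rewrite (mem_set xE) mulr1 in_setI (mem_set xE) andbT.
      have e : excess n.+1 x = g x + excess n (T x).
        by move: xE; rewrite /E /excess_set /= => xE; rewrite max_r //;
          move: xE; rewrite lt_max ltxx /= => /ltW.
      rewrite e /g indicE addrA [_ + (a - _)]addrC subrK.
      by rewrite lerD2l excessS.
    have e0 : excess n.+1 x = 0.
      by apply/eqP; rewrite eq_le excess_ge0 andbT leNgt; apply/negP.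
    by rewrite in_setI (memNset xE) andbF mulr0 !add0r e0 excess_ge0.
have dL : (\int[mu]_x ((\1_(C `&` E) x)%:E + (excess n.+1 x)%:E) =
    \int[mu]_x (\1_(C `&` E) x)%:E + \int[mu]_x (excess n.+1 x)%:E)%E.
  apply: ge0_integralD => //; [exact: mI| |exact: mex].
  by move=> x _; rewrite lee_fin excess_ge0.
have dR : (\int[mu]_x (a%:E * (\1_E x)%:E + (excess n.+1 (T x))%:E) =
    \int[mu]_x (a%:E * (\1_E x)%:E) + \int[mu]_x (excess n.+1 (T x))%:E)%E.
  apply: ge0_integralD => //.
    by move=> x _; rewrite -EFinM lee_fin mulr_ge0.
  by move=> x _; rewrite lee_fin excess_ge0.
rewrite dL dR in key.
move: key; rewrite integral_excess_shift integral_indic // setIT.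
rewrite ge0_integralZl_EFin //; last exact: mI.
rewrite integral_indic // setIT leeD2rE //.
have le : (\int[mu]_x (excess n.+1 x)%:E <= (n.+1%:R * a)%:E)%E.
  have mu1 : (mu : {measure set (seqsp U) -> \bar R}) setT = 1%E.
    exact: probability_setT.
  rewrite -[leRHS]mule1 -mu1 -(integral_cst mu measurableT).
  apply: ge0_le_integral => //; first by move=> x _; rewrite lee_fin excess_ge0.
    exact: mex.
  by move=> x _; rewrite lee_fin excess_le.
rewrite ge0_fin_numE; first exact: le_lt_trans le (ltry _).
by apply: integral_ge0 => x _; rewrite lee_fin excess_ge0.
Qed.

Definition visits n (x : seqsp U) : R := \sum_(0 <= l < n) \1_C (Defs.shift l x).

Lemma visitsS n x : visits n.+1 x = \1_C x + visits n (T x).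
Proof. by rewrite /visits big_nat_recl. Qed.

Lemma measurable_visits n : measurable_fun setT (visits n).
Proof.
apply: measurable_sum => l; apply: measurableT_comp.
  exact: measurable_indic.
exact: Defs.measurable_shift.
Qed.

(** The partial sums of [g] along the orbit of [x]. *)
Definition deficit n x := n%:R * a - visits n x.

Lemma deficitS n x : deficit n.+1 x = g x + deficit n (T x).
Proof. by rewrite /deficit visitsS /g -natr1; ring. Qed.

Lemma deficit_le_excess n x : deficit n x <= excess n x.
Proof.
elim: n x => [|n IH] x; first by rewrite /deficit /visits big_nil mul0r subr0.
by rewrite deficitS /= le_max lerD2l IH orbT.
Qed.

Definition unbounded_deficit : set (seqsp U) :=
  [set x | forall K : nat, exists n, K%:R < deficit n x].

Lemma measurable_unbounded_deficit : measurable unbounded_deficit.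
Proof.
have -> : unbounded_deficit = \bigcap_(K : nat) \bigcup_n [set x | K%:R < deficit n x].
  apply/seteqP; split=> x h K.
    by move=> _; have [n hn] := h K; exists n.
  by have [n _ hn] := h K I; exists n.
apply: bigcapT_measurable => K; apply: bigcupT_measurable => n.
apply: measurable_gt; apply: measurable_funB => //; exact: measurable_visits.
Qed.

Lemma unbounded_deficit_invariant : T @^-1` unbounded_deficit = unbounded_deficit.
Proof.
have g_le x : `|g x| <= a + 1.
  rewrite (le_trans (ler_normB _ _)) // ger0_norm // lerD2l indicE.
  by case: (_ \in _); rewrite ?normr1 ?normr0.
apply/seteqP; split=> x h K.
  have [n hn] := h (K + (Num.trunc (a + 1)).+1)%N; exists n.+1.
  rewrite deficitS; move: hn (g_le x) (truncnS_gt (a + 1)).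
  rewrite natrD ler_norml => hn /andP[h1 h2] h3; lra.
have [[|n] hn] := h (K + (Num.trunc (a + 1)).+1)%N.
  by move: hn; rewrite /deficit /visits big_nil mul0r subr0 ltNge ler0n.
exists n; move: hn (g_le x) (truncnS_gt (a + 1)); rewrite deficitS.
rewrite natrD ler_norml => hn /andP[h1 h2] h3; lra.
Qed.

(** If the deficit were unbounded almost everywhere, the excess would be positive
    almost everywhere in the limit, and the maximal inequality would bound the
    measure of [C] by [a]. *)
Lemma unbounded_deficit_null : ergodic mu -> (a%:E < mu C)%E ->
  mu unbounded_deficit = 0%E.
Proof.
move=> erg aC.
have [//|full] := erg _ measurable_unbounded_deficit unbounded_deficit_invariant.
exfalso; move: aC; rewrite ltNge => /negP; apply.
pose E n := excess_set n.
have mE n : measurable (E n) by exact: measurable_excess_set.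
have sub : unbounded_deficit `<=` \bigcup_n E n.
  move=> x /(_ 0%N)[[|n] hn].
    by move: hn; rewrite /deficit /visits big_nil mul0r subr0 ltxx.
  by exists n => //; exact: lt_le_trans hn (deficit_le_excess _ _).
have mbE : measurable (\bigcup_n E n) by exact: bigcupT_measurable.
have null : mu (~` \bigcup_n E n) = 0%E.
  rewrite probability_setC // (_ : mu _ = 1%E) ?subee //.
  apply/eqP; rewrite eq_le probability_le1 //= -full.
  by apply: le_measure; rewrite ?inE //; exact: measurable_unbounded_deficit.
have mCE n : measurable (C `&` E n) by exact: measurableI.
have mCB : measurable (C `&` ~` \bigcup_n E n).
  by apply: measurableI => //; exact: measurableC.
have muC : mu C = mu (\bigcup_n (C `&` E n)).
  rewrite -setI_bigcupr -[in LHS](setIT C) -[in LHS](setUv (\bigcup_n E n)) setIUr.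
  rewrite measureU //; last by rewrite setIACA setICr setI0.
    rewrite [X in (_ + X)%E](_ : _ = 0%E) ?adde0 //.
    by apply: subset_measure0 null => //; exact: measurableC.
  exact: measurableI.
rewrite muC.
have cv : (mu \o (fun n => C `&` E n)) n @[n --> \oo] --> mu (\bigcup_n (C `&` E n)).
  apply: nondecreasing_cvg_mu => //; first exact: bigcupT_measurable.
  move=> n m nm; apply/subsetPset; apply: setIS => x h.
  exact: (lt_le_trans h (@excess_homo n.+1 m.+1 x nm)).
rewrite -(cvg_lim (@ereal_hausdorff R) cv); apply: lime_le; first exact: cvgP cv.
apply: nearW => n; apply: (le_trans (maximal_inequality n)).
rewrite -[leRHS]mule1; apply: lee_wpmul2l; first by rewrite lee_fin.
exact: probability_le1.
Qed.

End maximal_inequality.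

(** The level [a] lies strictly between the required frequency and the measure of
    [C]. The deficit with respect to [a] is almost surely bounded, and the gap
    between the two levels absorbs this bound for long samples. *)
Lemma visits_lower_bound (C : set (seqsp U)) (th : R) : ergodic mu -> measurable C ->
  0 < th <= 1 -> \forall x \ae mu, exists N, forall n, (N <= n)%N ->
    n%:R * ((1 - th) * fine (mu C)) <= visits C n x.
Proof.
move=> erg mC /andP[th0 th1]; set p := fine (mu C).
have pE : mu C = p%:E by rewrite fineK // fin_num_measure.
have p0 : 0 <= p by rewrite -lee_fin -pE.
have vis0 n x : 0 <= visits C n x by apply: sumr_ge0 => l _; rewrite indicE.
have [pp|pp] := ltP 0 p; last first.
  apply: aeW => x; exists 0%N => n _.
  by rewrite (_ : p = 0) ?mulr0 //; apply/eqP; rewrite eq_le pp.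
pose a := (1 - th / 2) * p.
have a0 : 0 <= a by rewrite mulr_ge0 //; lra.
have aC : (a%:E < mu C)%E.
  by rewrite pE lte_fin /a -[ltRHS]mul1r ltr_pM2r //; lra.
have mB := measurable_unbounded_deficit a mC.
exists (unbounded_deficit C a); split=> //; first exact: unbounded_deficit_null.
move=> x /=; apply: contra_notP => /existsNP[K /forallNP hK].
have tp : 0 < th * p by rewrite mulr_gt0.
exists (Num.trunc (2 * K%:R / (th * p))).+1 => n hn.
have := hK n => /negP; rewrite -leNgt /deficit => h.
have h2 : 2 * K%:R <= n%:R * (th * p).
  rewrite -ler_pdivrMr //; apply: (le_trans (ltW (truncnS_gt _))).
  by rewrite ler_nat.
by move: h h2; rewrite /a; nra.
Qed.

End ergodic_frequencies.

(** * Empirical block laws and the choice of the block length *)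

(** The value at [n] is the largest [j <= n] whose threshold is at most [n], except
    that it is kept positive; hence the restriction to values above one in the last
    clause. *)
Lemma slow_sequence (N : nat -> nat) : exists k : nat -> nat,
  [/\ forall n, (0 < k n)%N, forall n, (1 <= n)%N -> (k n <= n)%N,
      k @ \oo --> \oo & forall n, (1 < k n)%N -> (N (k n) <= n)%N].
Proof.
pose m n := \max_(j < n.+1 | (N j <= n)%N) j.
have mn n : (m n <= n)%N by apply/bigmax_leqP => j _; rewrite -ltnS.
exists (fun n => maxn 1 (m n)); split=> [n|n n1||n].
- by rewrite leq_max.
- by rewrite geq_max n1 mn.
- move=> A [K _ hK]; exists (maxn K (N K)) => // n /=; rewrite geq_max => /andP[Kn NKn].
  apply: hK => /=; rewrite leq_max; apply/orP; right.
  have Kn' : (K < n.+1)%N by [].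
  exact: (@leq_bigmax_cond _ (fun j : 'I_n.+1 => (N j <= n)%N) (@nat_of_ord n.+1)
    (Ordinal Kn')).
- rewrite leq_max ltnn /= => m1.
  have mm : (maxn 1 (m n) = m n)%N by apply/maxn_idPr; exact: ltnW.
  rewrite mm.
  have : (0 < #|[pred j : 'I_n.+1 | (N j <= n)%N]|)%N.
    rewrite lt0n; apply/eqP => /card0_eq h0; move: m1.
    by rewrite /m big_pred0 // => j; have := h0 j; rewrite inE.
  by move=> /(eq_bigmax_cond (@nat_of_ord n.+1))[j]; rewrite inE => Nj; rewrite /m => ->.
Qed.

Section empirical.
Variables (R : realType) (U : pfinType).

Lemma empiricalE k n (x : seqsp U) (u : block k U) :
  empirical R n x u = (n - k + 1)%:R^-1 * visits R (cyl (codom u)) (n - k + 1) x.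
Proof.
congr (_ * _); apply: eq_bigr => l _; rewrite indicE cyl_codom; congr (_%:R).
congr nat_of_bool; apply/forallP/idP => [h|].
  by apply/mem_set/ffunP => i; rewrite ffunE; apply/esym/eqP/h.
by move=> /set_mem/= <- i; rewrite ffunE.
Qed.

Lemma empirical_pmf k n (x : seqsp U) : is_pmf (@empirical R U k n x).
Proof.
split=> [u|]; first by rewrite mulr_ge0 ?invr_ge0 ?ler0n // sumr_ge0.
rewrite -mulr_sumr exchange_big /=.
rewrite (eq_bigr (fun _ => 1)); last first.
  move=> l _; pose u : block k U := [ffun i : 'I_k => x (l + i)%N].
  rewrite (bigD1 u) //= big1 ?addr0.
    by rewrite (_ : [forall i, _]) //; apply/forallP => i; rewrite ffunE.
  move=> v vu; case: forallP => //= h; case/eqP: vu; apply/ffunP => i.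
  by rewrite ffunE; apply/eqP/h.
by rewrite sumr_const_nat subn0 mulVf // pnatr_eq0 addn1.
Qed.

Variable mu : probability (seqsp U) R.
Hypotheses (mu_stat : shift_invariant mu) (mu_erg : ergodic mu).

Lemma measurable_empirical k n (u : block k U) :
  measurable_fun setT (fun x => empirical R n x u).
Proof.
have -> : (fun x => empirical R n x u) =
    (fun x => (n - k + 1)%:R^-1 * visits R (cyl (codom u)) (n - k + 1) x).
  by apply/funext => x; rewrite empiricalE.
by apply: measurable_funM => //; apply: measurable_visits; exact: measurable_cyl.
Qed.

Definition undersampled k (th : R) N : set (seqsp U) :=
  \bigcup_(n in [set n | (N <= n)%N]) \bigcup_(u in [set: block k U])
    [set x | empirical R n x u < (1 - th) * block_law mu u].

Lemma measurable_undersampled k th N : measurable (undersampled k th N).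
Proof.
apply: bigcup_measurable => n _; apply: fin_bigcup_measurable => // u _.
have -> : [set x | empirical R n x u < (1 - th) * block_law mu u] =
    [set x | - ((1 - th) * block_law mu u) < - empirical R n x u].
  by apply/seteqP; split=> x /=; rewrite ltrN2.
apply: measurable_gt; apply: measurableT_comp => //.
exact: measurable_empirical.
Qed.

Lemma ae_eventually_sampled k th : 0 < th <= 1 -> \forall x \ae mu,
  exists N, forall n, (N <= n)%N -> forall u : block k U,
    (1 - th) * block_law mu u <= empirical R n x u.
Proof.
move=> th01.
have := @filter_forall _ (block k U) _ _ (ae_filter_ringOfSetsType mu)
  (fun u => visits_lower_bound mu_stat mu_erg (measurable_cyl (codom u)) th01).
apply: filterS => x /choice[N hN].
exists (\max_u N u + k)%N => n hn u; rewrite empiricalE.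
have n0 : 0 < (n - k + 1)%:R :> R by rewrite ltr0n addn1.
have Nn : (N u <= n - k + 1)%N.
  apply: (leq_trans (leq_bigmax u)); rewrite addn1; apply: leqW.
  by have := leq_sub2r k hn; rewrite addnK.
by rewrite ler_pdivlMl //; have := hN u _ Nn; rewrite block_lawE.
Qed.

Lemma undersampled_small k th (e : R) : 0 < th <= 1 -> 0 < e ->
  exists N, (mu (undersampled k th N) <= e%:E)%E.
Proof.
move=> th01 e0.
have mu_ := measurable_undersampled k th.
have mI : measurable (\bigcap_N undersampled k th N) by exact: bigcapT_measurable.
have null : mu (\bigcap_N undersampled k th N) = 0%E.
  apply/negligibleP => //; apply: negligibleS (ae_eventually_sampled k th01).
  move=> x hx /= [N hN]; have [n Nn [u _]] := hx N I.
  by rewrite /= ltNge hN.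
have cv : (mu \o undersampled k th) N @[N --> \oo] --> mu (\bigcap_N undersampled k th N).
  apply: nonincreasing_cvg_mu => //.
    by rewrite (le_lt_trans (probability_le1 mu (mu_ 0%N))) ?ltry.
  move=> n m nm; apply/subsetPset => x [n' /= mn']; exists n' => //=.
  exact: leq_trans mn'.
rewrite null in cv; have /fine_cvgP[_ /cvgr_le/(_ e e0)[N _ hN]] := cv.
exists N; have := hN N (leqnn N); rewrite -lee_fin /= fineK //.
exact: fin_num_measure.
Qed.

(** The thresholds are chosen so large that the sets of badly sampled sequences have
    summable measures, and the lemma of Borel and Cantelli applies. *)
Lemma eventually_sampled_blocks : exists (N : nat -> nat) (A : set (seqsp U)),
  [/\ measurable A, mu A = 1%E & forall x, A x -> exists K, forall k n,
    (K <= k)%N -> (N k <= n)%N -> forall u : block k U,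
      (1 - k.+1%:R^-1) * block_law mu u <= empirical R n x u].
Proof.
have /choice[N hN] : forall k, exists N,
    (mu (undersampled k k.+1%:R^-1 N) <= (1 / (2 ^ k.+1)%:R)%:E)%E.
  move=> k; apply: undersampled_small.
    by rewrite invr_gt0 ltr0n /= invf_le1 ?ler1n ?ltr0n.
  by rewrite divr_gt0 // ltr0n expn_gt0.
pose B k := undersampled k k.+1%:R^-1 (N k).
have mB k : measurable (B k) by exact: measurable_undersampled.
have mL : measurable (lim_sup_set B).
  by apply: bigcapT_measurable => n; apply: bigcup_measurable.
have L0 : mu (lim_sup_set B) = 0%E.
  apply: lim_sup_set_cvg0 => //.
  have le1 := @epsilon_trick0 R 1 xpredT ler01.
  apply: (le_lt_trans _ (ltry 1)); apply: (le_trans _ le1).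
  by apply: lee_nneseries => // k _; exact: hN.
exists N, (~` lim_sup_set B); split; first exact: measurableC.
  by rewrite probability_setC // L0 sube0.
move=> x /existsNP[K]; rewrite not_implyE => -[_ hK].
exists K => k n Kk Nn u; rewrite leNgt; apply/negP => lt.
by apply: hK; exists k => //; exists n => //; exists u.
Qed.

End empirical.

(** * The entropy rate of a stationary measure *)

(** Fekete's argument: an index whose value is close to the infimum bounds all later
    values, up to a term of order [1 / k]. *)
Lemma cvg_approx_subadditive (R : realType) (a : nat -> R) (C : R) :
  0 <= C -> (forall k, (0 < k)%N -> 0 <= a k) ->
  (forall m k, (0 < m)%N -> (0 < k)%N -> a k <= a m + m%:R * C / k%:R) ->
  cvgn a /\ (forall m, (0 < m)%N -> limn a <= a m).
Proof.
move=> C0 a0 aa; pose S := [set a m | m in [set m | (0 < m)%N]].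
have hS : has_inf S.
  by split; [exists (a 1%N), 1%N|exists 0 => _ [m m0 <-]; exact: a0].
have lb m : (0 < m)%N -> inf S <= a m.
  by move=> m0; apply: ge_inf; [exact: hS.2|exists m].
suff cv : a @ \oo --> inf S.
  by split; [exact: cvgP cv|move=> m m0; rewrite (cvg_lim (@Rhausdorff R) cv) lb].
apply/cvgrPdist_le => e e0.
have e2 : 0 < e / 2 by rewrite divr_gt0.
have [_ [m m0 <-] hm] := inf_adherent e2 hS.
exists (Num.trunc (m%:R * C / (e / 2))).+1 => // k /= hk.
have k0 : (0 < k)%N by apply: leq_trans hk.
have kR : 0 < k%:R :> R by rewrite ltr0n.
have h1 : m%:R * C / k%:R <= e / 2.
  rewrite ler_pdivrMr // [leRHS]mulrC -ler_pdivrMr //.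
  by apply: (le_trans (ltW (truncnS_gt _))); rewrite ler_nat.
rewrite distrC ler_norml; have := lb k k0; have := aa m k m0 k0; move: hm h1; lra.
Qed.

Section entropy_rate.
Variables (R : realType) (U : pfinType) (P : probability (seqsp U) R).
Hypothesis P_stat : shift_invariant P.

Lemma cyclic_law_block_law k m t : (t + m <= k)%N ->
  @cyclic_law U R k (block_law P) m t = block_law P.
Proof.
move=> tk; apply/funext => v; apply: EFin_inj; rewrite -block_lawE cyclic_lawE.
have sv : size (codom v) = m by rewrite size_codom card_ord.
by rewrite -{1}sv block_law_window // sv.
Qed.

Lemma entropy_block_law_ge0 k : 0 <= entropy (@block_law R U k P).
Proof. by apply: entropy_ge0; exact: block_law_pmf. Qed.

(** For a stationary measure, all windows that do not run over the end of the block
    have the same law, so the bound on cyclic windows gives subadditivity up to a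
    boundary term. *)
Lemma entropy_block_law_approx m k : (0 < m)%N -> (0 < k)%N ->
  k%:R^-1 * entropy (@block_law R U k P) <=
  m%:R^-1 * entropy (@block_law R U m P) + m%:R * (2 * ln #|U|%:R) / k%:R.
Proof.
move=> m0 k0; set L := ln _; have L0 : 0 <= L by exact: ln_card_ge0.
have kR : 0 < k%:R :> R by rewrite ltr0n.
have mR : 0 < m%:R :> R by rewrite ltr0n.
have gp : is_pmf (@block_law R U k P) by exact: block_law_pmf.
set Hm := entropy (@block_law R U m P).
have Hm0 : 0 <= Hm by exact: entropy_block_law_ge0.
have step : \sum_(t < k) entropy (@cyclic_law U R k (block_law P) m t) <=
    k%:R * Hm + m%:R * (m%:R * L).
  have le t : entropy (@cyclic_law U R k (block_law P) m t) <=
      Hm + ((k < t + m)%N)%:R * (m%:R * L).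
    have [tk|tk] := ltnP k (t + m) => /=; last first.
      by rewrite cyclic_law_block_law // mul0r addr0.
    rewrite mul1r (le_trans (entropy_block_le _)) ?lerDr //.
    exact: cyclic_law_pmf.
  apply: (@le_trans _ _ (\sum_(t < k) (Hm + ((k < t + m)%N)%:R * (m%:R * L)))).
    by apply: ler_sum => t _; exact: le.
  rewrite big_split /= sumr_const card_ord -[X in X + _]mulr_natl lerD2l.
  rewrite -mulr_suml ler_wpM2r ?mulr_ge0 ?ler0n //.
  by rewrite -natr_sum ler_nat overlap_count.
have := le_trans (entropy_cyclic_windows gp k0 m0) (lerD step (lexx _)).
rewrite -/L => h.
rewrite mulrC ler_pdivrMr // mulrDl divfK ?gt_eqF // -(ler_pM2l mR) (le_trans h) //.
by rewrite le_eqVlt; apply/orP; left; apply/eqP; field; rewrite gt_eqF.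
Qed.

Lemma entropy_rate_spec :
  (k%:R^-1 * entropy (@block_law R U k P) @[k --> \oo] --> entropy_rate P) /\
  forall m, (0 < m)%N -> entropy_rate P <= m%:R^-1 * entropy (@block_law R U m P).
Proof.
apply: (@cvg_approx_subadditive R
    (fun k => k%:R^-1 * entropy (@block_law R U k P)) (2 * ln #|U|%:R)).
- by rewrite mulr_ge0 // ln_card_ge0.
- by move=> k _; rewrite mulr_ge0 ?invr_ge0 ?ler0n // entropy_block_law_ge0.
- by move=> m k; exact: entropy_block_law_approx.
Qed.

End entropy_rate.

(** * Letter-to-letter factors *)

Section letter_map.
Variables (R : realType) (U V : pfinType) (phi : U -> V).

Definition map_seqsp (z : seqsp U) : seqsp V := fun n => phi (z n).

Definition map_block k (u : block k U) : block k V := [ffun i => phi (u i)].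

Lemma mkseq_map_seqsp (z : seqsp U) n : mkseq (map_seqsp z) n = map phi (mkseq z n).
Proof. by rewrite /mkseq -map_comp. Qed.

Lemma codom_prefix k (z : seqsp U) : codom (prefix k z) = mkseq z k.
Proof.
have : cyl (codom (prefix k z)) z by rewrite cyl_codom.
by rewrite /cyl /= size_codom card_ord.
Qed.

Lemma map_seqsp_cyl s : map_seqsp @^-1` cyl s =
  [set z | map phi (codom (prefix (size s) z)) == s].
Proof.
apply/seteqP; split=> z; rewrite /= /cyl /= codom_prefix mkseq_map_seqsp.
  by move=> ->.
by move/eqP.
Qed.

Lemma measurable_map_seqsp : measurable_fun setT map_seqsp.
Proof.
by apply: measurable_fun_seqsp => s; rewrite map_seqsp_cyl;
  exact: (measurable_prefix (fun u => map phi (codom u) == s)).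
Qed.

Lemma cyc_map_block k (u : block k U) i : (0 < k)%N ->
  cyc (map_block u) i = phi (cyc u i).
Proof.
move=> k0; have ik : (i %% k < k)%N by rewrite ltn_mod.
rewrite -cyc_modn -[cyc u i]cyc_modn.
by rewrite (_ : (i %% k)%N = Ordinal ik) // !cyc_ord ffunE.
Qed.

Lemma cyclic_words_map k (g : block k U -> R) s : (0 < k)%N ->
  cyclic_words (image_law (@map_block k) g) s =
  \sum_(w : block (size s) U | map phi (codom w) == s) cyclic_words g (codom w).
Proof.
move=> k0; rewrite exchange_big /=; apply: eq_bigr => t _; rewrite -mulr_sumr.
congr (_ * _).
under [RHS]eq_bigr => w _ do rewrite size_codom card_ord -cyclic_lawE.
rewrite !image_law_sum; apply: eq_bigl => u; rewrite codom_cyclic_window.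
congr (_ == s); rewrite /mkseq -map_comp; apply: eq_map => i /=.
exact: cyc_map_block.
Qed.

Lemma cyclic_words_lower_bound k (al : block k V -> R)
    (mu : probability (seqsp V) R) (th : R) s : (0 < k)%N -> shift_invariant mu ->
  is_pmf al -> th <= 1 -> (forall v, (1 - th) * block_law mu v <= al v) ->
  (1 - th) * (1 - (size s)%:R / k%:R) * fine (mu (cyl s)) <= cyclic_words al s.
Proof.
move=> k0 mu_stat [al0 _] th1 dom; set m := size s; set p := fine _.
have kR : 0 < k%:R :> R by rewrite ltr0n.
have pE : mu (cyl s) = p%:E.
  by rewrite fineK // fin_num_measure //; exact: measurable_cyl.
have p0 : 0 <= p by rewrite -lee_fin -pE.
have le t : (1 - th) * p * (1 - (k < t + m)%:R) <=
    \sum_(u | mkseq (fun i => cyc u (t + i)) m == s) al u.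
  have [tk|tk] := ltnP k (t + m) => /=.
    by rewrite subrr mulr0 sumr_ge0.
  rewrite subr0 mulr1.
  have <- : \sum_(u : block k V | mkseq (fun i => cyc u (t + i)) m == s)
      block_law mu u = p.
    by apply: EFin_inj; rewrite -pE -(block_law_window mu_stat tk).
  by rewrite mulr_sumr; apply: ler_sum => u _.
apply: (@le_trans _ _
    (\sum_(t < k) k%:R^-1 * ((1 - th) * p * (1 - (k < t + m)%:R)))); last first.
  by apply: ler_sum => t _; rewrite ler_wpM2l // invr_ge0 ltW.
rewrite -mulr_sumr -mulr_sumr sumrB sumr_const card_ord -natr_sum.
have -> : (1 - th) * (1 - m%:R / k%:R) * p = k%:R^-1 * ((1 - th) * p * (k%:R - m%:R)).
  by field; rewrite gt_eqF.
rewrite ler_wpM2l ?invr_ge0 ?(ltW kR) // ler_wpM2l ?mulr_ge0 ?subr_ge0 //.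
by rewrite lerD2l lerN2 ler_nat overlap_count.
Qed.

End letter_map.

(** * Marginals of limits *)

Section limit_marginals.
Variables (R : realType) (U V : pfinType) (phi : U -> V).

Lemma codom_of_seq (W : pfinType) (s : seq W) :
  exists u : block (size s) W, codom u = s.
Proof.
exists [ffun i : 'I_(size s) => nth point s i].
apply: (@eq_from_nth _ point); rewrite size_codom card_ord // => i im.
by rewrite (nth_codom_ord _ _ (Ordinal im)) ffunE.
Qed.

Lemma prob_map_seqsp (P : probability (seqsp U) R) s :
  P (map_seqsp phi @^-1` cyl s) =
  (\sum_(w : block (size s) U | map phi (codom w) == s) block_law P w)%:E.
Proof. by rewrite map_seqsp_cyl (prob_prefix P (fun u => map phi (codom u) == s)). Qed.

Lemma image_block_law (P : probability (seqsp U) R) k (v : block k V) :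
  (image_law (@map_block U V phi k) (block_law P) v)%:E =
  P (map_seqsp phi @^-1` cyl (codom v)).
Proof.
rewrite cyl_codom /image_law -(prob_prefix P (fun u => map_block phi u == v)).
congr (P _); apply/seteqP; split=> z /=.
  by move/eqP <-; apply/ffunP => i; rewrite !ffunE.
by move=> <-; apply/eqP/ffunP => i; rewrite !ffunE.
Qed.

Lemma cvg_inv_length (k : nat -> nat) : k @ \oo --> \oo ->
  (k n)%:R^-1 @[n --> \oo] --> (0 : R).
Proof.
move=> koo; apply/cvgrPdist_lt => e e0.
have : \forall n \near \oo, ((Num.trunc e^-1).+1 <= k n)%N.
  exact: (koo _ (nbhs_infty_ge (Num.trunc e^-1).+1)).
apply: filterS => n hn; rewrite sub0r normrN ger0_norm ?invr_ge0 ?ler0n //.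
rewrite -[e]invrK ltf_pV2 ?posrE ?invr_gt0 ?ltr0n ?(leq_trans _ hn) //.
by apply: (lt_le_trans (truncnS_gt e^-1)); rewrite ler_nat.
Qed.

(** Domination of the marginals up to a vanishing factor passes to the limit, and
    a probability measure that dominates another one is equal to it. *)
Lemma limit_marginal (mu : probability (seqsp V) R) (lam : probability (seqsp U) R)
    (k : nat -> nat) (g : forall j, block (k j) U -> R) (th : nat -> R) :
  shift_invariant mu -> (forall j, (0 < k j)%N) -> k @ \oo --> \oo ->
  (forall j, th j <= 1) -> th @ \oo --> (0 : R) -> (forall j, is_pmf (g j)) ->
  (forall j v, (1 - th j) * block_law mu v <= image_law (@map_block U V phi _) (g j) v) ->
  (forall s, cyclic_words (g j) s @[j --> \oo] --> fine (lam (cyl s))) ->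
  forall A, measurable A -> lam (map_seqsp phi @^-1` A) = mu A.
Proof.
move=> mu_stat k0 koo th1 th0 gp dom cv.
have [Q QE] := image_probability lam (@measurable_map_seqsp U V phi).
have le s : fine (mu (cyl s)) <= fine (Q (cyl s)).
  set p := fine (mu (cyl s)); rewrite -subr_ge0.
  have c1 : cyclic_words (image_law (@map_block U V phi (k j)) (g j)) s @[j --> \oo] -->
      fine (Q (cyl s)).
    rewrite QE prob_map_seqsp /=.
    under eq_fun do rewrite cyclic_words_map //.
    apply: cvg_sumr => w _; have := cv (codom w).
    by rewrite block_lawE.
  have c2 : (1 - th j) * (1 - (size s)%:R / (k j)%:R) * p @[j --> \oo] --> p.
    have {2}-> : p = (1 - 0) * (1 - (size s)%:R * 0) * p.
      by rewrite mulr0 !subr0 !mul1r.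
    apply: cvgM; last exact: cvg_cst.
    apply: cvgM; first by apply: cvgB => //; exact: cvg_cst.
    apply: cvgB; first exact: cvg_cst.
    by apply: cvgMr; exact: cvg_inv_length.
  apply: (cvgr_to_ge (cvgB c1 c2)); apply: nearW => j /=; rewrite subr_ge0.
  apply: cyclic_words_lower_bound => //; exact: image_law_pmf.
have eqb n (v : block n V) : block_law mu v = block_law Q v.
  have h (u : block n V) : true -> 0 <= block_law Q u - block_law mu u.
    by move=> _; rewrite subr_ge0; have := le (codom u); rewrite !block_lawE.
  have s0 : \sum_(u : block n V) (block_law Q u - block_law mu u) = 0.
    by rewrite sumrB (block_law_pmf Q n).2 (block_law_pmf mu n).2 subrr.
  by have /(_ v isT)/eqP := psumr_eq0P h s0; rewrite subr_eq0 => /eqP.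
move=> A mA; rewrite -QE; apply: eq_measure_cyl => //.
  by rewrite (le_lt_trans (probability_le1 Q measurableT)) ?ltry.
move=> s; have [v <-] := codom_of_seq s.
by have := block_lawE Q v; rewrite -eqb -block_lawE.
Qed.

End limit_marginals.

(** * Joinings and couplings of block laws *)

Section pairs.
Variables (R : realType) (X Y : pfinType).
Local Notation Z := (X * Y)%type.

Definition zip_block k (w : block k X * block k Y) : block k Z :=
  [ffun i => (w.1 i, w.2 i)].

Definition unzip_block k (u : block k Z) : block k X * block k Y :=
  (map_block fst u, map_block snd u).

Lemma zip_blockK k : cancel (@zip_block k) (@unzip_block k).
Proof. by move=> [u v]; congr pair; apply/ffunP => i; rewrite !ffunE. Qed.

Lemma unzip_blockK k : cancel (@unzip_block k) (@zip_block k).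
Proof. by move=> u; apply/ffunP => i; rewrite !ffunE /=; case: (u i). Qed.

Lemma sum_zip_block k (F : block k Z -> R) : \sum_u F u = \sum_w F (zip_block w).
Proof.
apply: reindex; exists (@unzip_block k) => w _;
  [exact: zip_blockK|exact: unzip_blockK].
Qed.

Lemma pair_block_law_zip k (p : block k X * block k Y -> R) w :
  pair_block_law p (zip_block w) = p w.
Proof.
by rewrite -[in RHS](zip_blockK w).
Qed.

Lemma pair_block_law_pmf k (p : block k X * block k Y -> R) :
  is_pmf p -> is_pmf (pair_block_law p).
Proof.
move=> [p0 p1]; split; first by move=> u; exact: p0.
by rewrite sum_zip_block -p1; apply: eq_bigr => w _; exact: pair_block_law_zip.
Qed.

Lemma entropy_pair_block_law k (p : block k X * block k Y -> R) :
  entropy (pair_block_law p) = entropy p.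
Proof. exact: (entropy_bij p (@zip_blockK k) (@unzip_blockK k)). Qed.

Lemma image_law_fst k (p : block k X * block k Y -> R) u :
  image_law (@map_block Z X fst k) (pair_block_law p) u = \sum_v p (u, v).
Proof.
rewrite /image_law big_mkcond sum_zip_block sum_pair (bigD1 u) //=.
rewrite [X in _ + X]big1 ?addr0.
  apply: eq_bigr => v _; rewrite pair_block_law_zip ifT //.
  by apply/eqP/ffunP => i; rewrite !ffunE.
move=> u' uu'; apply: big1 => v _; case: ifP => // /eqP e; case/eqP: uu'.
by rewrite -e; apply/ffunP => i; rewrite !ffunE.
Qed.

Lemma image_law_snd k (p : block k X * block k Y -> R) v :
  image_law (@map_block Z Y snd k) (pair_block_law p) v = \sum_u p (u, v).
Proof.
rewrite /image_law big_mkcond sum_zip_block sum_pair; apply: eq_bigr => u _.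
rewrite (bigD1 v) //= big1 ?addr0.
  by rewrite pair_block_law_zip ifT //; apply/eqP/ffunP => i; rewrite !ffunE.
move=> v' vv'; case: ifP => // /eqP e; case/eqP: vv'.
by rewrite -e; apply/ffunP => i; rewrite !ffunE.
Qed.

Variable c : X * Y -> R.

Lemma average_block_cost k (p : block k X * block k Y -> R) : (0 < k)%N ->
  k%:R^-1 * expect p (@block_cost R X Y c k) =
  expect (cyclic_avg (pair_block_law p) (m := 1)) (fun v => c (v ord0)).
Proof.
move=> k0; pose g := pair_block_law p.
have -> : expect p (@block_cost R X Y c k) = \sum_(t < k) \sum_u g u * c (u t).
  rewrite exchange_big sum_zip_block /expect /=; apply: eq_bigr => w _.
  rewrite /g pair_block_law_zip -mulr_sumr mulrC; congr (_ * _).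
  by apply: eq_bigr => t _; rewrite ffunE.
rewrite /expect /cyclic_avg.
under [RHS]eq_bigr => v _ do rewrite mulr_sumr.
rewrite [RHS]exchange_big [LHS]mulr_sumr /=; apply: eq_bigr => t _.
under [RHS]eq_bigr => v _ do rewrite mulrCA.
rewrite -mulr_sumr; congr (_ * _).
under [RHS]eq_bigr => v _ do rewrite mulrC.
rewrite (sum_image_law _ _ (fun v : block 1 Z => c (v ord0))).
by apply: eq_bigr => u _; rewrite ffunE addn0 cyc_ord.
Qed.

Variables (mu : probability (seqsp X) R) (nu : probability (seqsp Y) R).

Section joining_coupling.
Variable lam : probability (seqsp Z) R.
Hypothesis J : joinings mu nu lam.

Definition joining_coupling k (w : block k X * block k Y) : R :=
  block_law lam (zip_block w).

Lemma pair_joining_coupling k : pair_block_law (@joining_coupling k) = block_law lam.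
Proof.
by apply/funext => u; rewrite -[in RHS](unzip_blockK u).
Qed.

Lemma joining_coupling_coupling k :
  couplings (block_law mu) (block_law nu) (@joining_coupling k).
Proof.
have [stat mu_ nu_] := J; split.
- split; first by move=> w; exact: block_law_ge0.
  by rewrite -(sum_zip_block (block_law lam)) (block_law_pmf lam k).2.
- move=> u; apply: EFin_inj.
  rewrite -image_law_fst pair_joining_coupling image_block_law -block_lawE -mu_ //.
  exact: measurable_cyl.
- move=> v; apply: EFin_inj.
  rewrite -image_law_snd pair_joining_coupling image_block_law -block_lawE -nu_ //.
  exact: measurable_cyl.
Qed.

Lemma cyclic_avg_block_law k : (0 < k)%N ->
  @cyclic_avg Z R k (block_law lam) 1 = block_law lam.
Proof.
have [stat _ _] := J; move=> k0; apply/funext => v; rewrite /cyclic_avg.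
rewrite (eq_bigr (fun=> k%:R^-1 * block_law lam v)); last first.
  by move=> t _; rewrite cyclic_law_block_law // addn1.
by rewrite -mulr_suml (pmf_uniform R k0).2 mul1r.
Qed.

(** The mean cost per letter of the block coupling is the mean cost of the joining,
    and the entropy rate is the infimum of the normalized block entropies. *)
Lemma joining_coupling_obj k eta : (0 < k)%N -> 0 <= eta ->
  k%:R^-1 * eot_obj (@block_cost R X Y c k) eta (@joining_coupling k) <=
  eoj_obj c eta lam.
Proof.
have [stat _ _] := J; move=> k0 eta0; rewrite /eot_obj mulrBr average_block_cost //.
rewrite pair_joining_coupling cyclic_avg_block_law // lerD2l lerN2 mulrCA ler_wpM2l //.
rewrite -entropy_pair_block_law pair_joining_coupling.
exact: (entropy_rate_spec stat).2.
Qed.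

End joining_coupling.
End pairs.

(** * Limits of couplings are joinings *)

Lemma shift_invariant_cyl (R : realType) (U : pfinType) (P : probability (seqsp U) R) :
  (forall s, \sum_a fine (P (cyl (a :: s))) = fine (P (cyl s))) -> shift_invariant P.
Proof.
move=> h; have [Q QE] := image_probability P (@Defs.measurable_shift U 1).
move=> A mA; rewrite -QE; apply: eq_measure_cyl mA => [|s].
  by rewrite (le_lt_trans (probability_le1 Q measurableT)) ?ltry.
have fin s' : P (cyl s') = (fine (P (cyl s')))%:E.
  by rewrite fineK // fin_num_measure //; exact: measurable_cyl.
rewrite [RHS]fin -h -sumEFin [LHS]QE.
have mS : measurable (@Defs.shift U 1 @^-1` cyl s).
  by rewrite -[X in measurable X]setTI; apply: Defs.measurable_shift => //;
    exact: measurable_cyl.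
have -> : @Defs.shift U 1 @^-1` cyl s =
    @Defs.shift U 1 @^-1` cyl s `&` [set x | xpredT (x 0%N : U)].
  by apply/seteqP; split=> [x|x []].
have mc (a : U) : measurable ((fun x : seqsp U => x 0%N : U) @^-1` [set a]).
  exact: (measurable_coord 0 [set a]).
apply: (etrans (@measure_fibers R U P _ U (fun x : seqsp U => x 0%N) xpredT mS mc)).
apply: eq_bigr => a _; rewrite -fin; congr (P _).
have e (x : seqsp U) : mkseq x (size s).+1 = x 0%N :: mkseq (Defs.shift 1 x) (size s).
  rewrite /mkseq /= -[1%N]addn0 iotaDl -map_comp.
  by congr (_ :: _).
apply/seteqP; split=> x; rewrite /cyl /= e.
  by move=> [-> ->].
by move=> -[-> ->].
Qed.

Lemma cvgnoo_subseq (k t : nat -> nat) : {homo t : m n / (m < n)%N} ->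
  k @ \oo --> \oo -> (k \o t) @ \oo --> \oo.
Proof.
move=> ht koo A /koo [N _ hN]; exists N => // n /= Nn; apply: hN => /=.
exact: leq_trans (homo_ltn_ge ht n).
Qed.

Section limits.
Variables (R : realType) (X Y : pfinType) (c : X * Y -> R) (eta : R).
Hypotheses (c_ge0 : forall w, 0 <= c w) (eta_gt0 : 0 < eta).
Variables (mu : probability (seqsp X) R) (nu : probability (seqsp Y) R).
Hypotheses (mu_stat : shift_invariant mu) (nu_stat : shift_invariant nu).
Local Notation Z := (X * Y)%type.

Variables (k : nat -> nat) (al : forall j, block (k j) X -> R)
  (be : forall j, block (k j) Y -> R) (th : nat -> R)
  (p : forall j, block (k j) X * block (k j) Y -> R).
Hypotheses (k_gt0 : forall j, (0 < k j)%N) (k_oo : k @ \oo --> \oo).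
Hypotheses (th_gt0 : forall j, 0 < th j) (th_le1 : forall j, th j <= 1)
  (th_0 : th @ \oo --> (0 : R)).
Hypothesis al_dom : forall j u, (1 - th j) * block_law mu u <= @al j u.
Hypothesis be_dom : forall j v, (1 - th j) * block_law nu v <= @be j v.
Hypothesis p_coupling : forall j, couplings (@al j) (@be j) (@p j).

Let g j := pair_block_law (@p j).

Let g_pmf j : is_pmf (@g j).
Proof. by apply: pair_block_law_pmf; have [] := p_coupling j. Qed.

(** The averaged cyclic word laws of the couplings are exactly consistent and shift
    invariant, so along a subsequence they converge to the word probabilities of a
    stationary measure. Its marginals are right by domination. The expected cost is
    continuous, and the entropy per letter of a coupling is, up to a vanishing
    term, at most the normalized entropy of its windows of any fixed length. *)
Lemma limit_joining : exists t : nat -> nat, {homo t : m n / (m < n)%N} /\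
  exists lam, [/\ joinings mu nu lam,
    weak_cvg (fun n => joining_estimator (@p (t n))) lam &
    forall e, 0 < e -> \forall n \near \oo, eoj_obj c eta lam - e <=
      (k (t n))%:R^-1 * eot_obj (@block_cost R X Y c (k (t n))) eta (@p (t n))].
Proof.
have [t [ht [L hL]]] := @bounded_family_subseq R (seq Z) (fun j => cyclic_words (@g j))
  (fun j s => introT andP (conj (cyclic_words_ge0 s (g_pmf j))
                                (cyclic_words_le1 s (g_pmf j) (k_gt0 j)))).
exists t; split => //.
have uniq (u : nat -> R) (l l' : R) : u @ \oo --> l -> u @ \oo --> l' -> l = l'.
  exact: (@cvg_unique _ (@Rhausdorff R)).
have L0 s : 0 <= L s.
  by apply: (cvgr_to_ge (hL s)); apply: nearW => j; exact: cyclic_words_ge0.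
have Lnil : L [::] = 1.
  apply: (uniq _ _ _ (hL [::])); under eq_fun do rewrite cyclic_words_nil //.
  exact: cvg_cst.
have Lrcons s : \sum_a L (rcons s a) = L s.
  apply: (uniq _ _ _ _ (hL s)); under eq_fun do rewrite -cyclic_words_rcons.
  by apply: cvg_sumr => a _; exact: hL.
have Lcons s : \sum_a L (a :: s) = L s.
  apply: (uniq _ _ _ _ (hL s)); under eq_fun do rewrite -cyclic_words_cons.
  by apply: cvg_sumr => a _; exact: hL.
have [lam lamE] := cylinder_extension L0 Lnil Lrcons.
have lamfine s : fine (lam (cyl s)) = L s by rewrite lamE.
have stat : shift_invariant lam.
  apply: shift_invariant_cyl => s; rewrite lamfine -Lcons.
  by apply: eq_bigr => a _; rewrite lamfine.
have kt_oo : (k \o t) @ \oo --> \oo by exact: cvgnoo_subseq.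
have tht_0 : (th \o t) @ \oo --> (0 : R) by exact: cvgn_subseq ht th_0.
have hL' s : cyclic_words (@g (t n)) s @[n --> \oo] --> fine (lam (cyl s)).
  by rewrite lamfine; exact: hL.
exists lam; split.
- split => // A mA.
  + apply: (@limit_marginal R Z X fst mu lam (k \o t) (fun n => @g (t n)) (th \o t)) => //=.
    by move=> j v; rewrite image_law_fst; have [_ -> _] := p_coupling (t j).
  + apply: (@limit_marginal R Z Y snd nu lam (k \o t) (fun n => @g (t n)) (th \o t)) => //=.
    by move=> j v; rewrite image_law_snd; have [_ _ ->] := p_coupling (t j).
- apply: weak_cvg_cyl => [n|s]; first exact: randomized_block_measureT.
  have /choice[r hr] : forall n, exists r : R,
      joining_estimator (@p (t n)) (cyl s) = r%:E /\
      `|r - cyclic_words (@g (t n)) s| <= (size s)%:R / (k (t n))%:R.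
    move=> n; have [r h1 h2] := randomized_block_measure_cyl (k_gt0 (t n)) (g_pmf (t n)) s.
    by exists r.
  under eq_fun do rewrite (hr _).1.
  rewrite lamE; apply: cvg_EFin; first exact: nearW.
  have d0 : r n - cyclic_words (@g (t n)) s @[n --> \oo] --> (0 : R).
    have s0 : (size s)%:R / (k (t n))%:R @[n --> \oo] --> (0 : R).
      rewrite -[X in _ --> X](mulr0 (size s)%:R).
      by apply: cvgMr; exact: (@cvg_inv_length R (k \o t)).
    apply: (@squeeze_cvgr _ _ _ _ (fun n => - ((size s)%:R / (k (t n))%:R))
      (fun n => (size s)%:R / (k (t n))%:R)) => //.
      by apply: nearW => n; have := (hr n).2; rewrite ler_norml.
    by rewrite -oppr0; apply: cvgN.
  rewrite -[L s]add0r.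
  have -> : fine \o (fun n => (r n)%:E) = (fun n => (r n - cyclic_words (@g (t n)) s) +
      cyclic_words (@g (t n)) s) by apply/funext => n; rewrite /= subrK.
  exact: cvgD d0 (hL s).
- move=> e e0.
  pose h := entropy_rate lam.
  pose H m := m%:R^-1 * entropy (@block_law R Z m lam).
  have [hc _] := entropy_rate_spec stat.
  have [m m0 hm] : exists2 m, (0 < m)%N & H m < h + e / (2 * eta).
    have : \forall m \near \oo, H m < h + e / (2 * eta).
      by apply: (cvgr_lt _ hc); rewrite ltrDl divr_gt0 // mulr_gt0.
    by move=> [M _ hM]; exists M.+1 => //; apply: hM => /=.
  have cavg m' (v : block m' Z) :
      @cyclic_avg Z R _ (@g (t n)) m' v @[n --> \oo] --> block_law lam v.
    under eq_fun do rewrite cyclic_avgE.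
    by have := hL' (codom v); rewrite block_lawE.
  have cA : expect (@cyclic_avg Z R _ (@g (t n)) 1) (fun v => c (v ord0)) @[n --> \oo] -->
      expect (@block_law R Z 1 lam) (fun v => c (v ord0)).
    by apply: cvg_sumr => v _; apply: cvgMr; exact: cavg.
  pose B n := m%:R^-1 * entropy (@cyclic_avg Z R _ (@g (t n)) m) +
    m%:R * ln #|{: Z}|%:R / (k (t n))%:R.
  have cB : B n @[n --> \oo] --> H m.
    rewrite -[X in _ --> X]addr0; apply: cvgD.
      apply: cvgMr; apply: cvg_entropy => // n.
      exact: cyclic_avg_pmf.
    rewrite -[X in _ --> X](mulr0 (m%:R * ln #|{: Z}|%:R)).
    by apply: cvgMr; exact: (@cvg_inv_length R (k \o t)).
  have cAB : expect (@cyclic_avg Z R _ (@g (t n)) 1) (fun v => c (v ord0)) - eta * B n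
      @[n --> \oo] --> expect (@block_law R Z 1 lam) (fun v => c (v ord0)) - eta * H m.
    by apply: cvgB => //; apply: cvgMr.
  have lt : eoj_obj c eta lam - e <
      expect (@block_law R Z 1 lam) (fun v => c (v ord0)) - eta * H m.
    rewrite /eoj_obj -/h.
    have : eta * H m < eta * h + e / 2.
      have -> : eta * h + e / 2 = eta * (h + e / (2 * eta)) by field; rewrite gt_eqF.
      by rewrite ltr_pM2l.
    by lra.
  have [N _ hN] := cvgr_ge _ cAB _ lt.
  exists N => // n Nn; apply: (le_trans (hN n Nn)).
  rewrite /eot_obj mulrBr average_block_cost // lerD2l lerN2 mulrCA ler_wpM2l ?(ltW eta_gt0) //.
  rewrite -entropy_pair_block_law; exact: entropy_cyclic_avg.
Qed.

Hypothesis al_pmf : forall j, is_pmf (@al j).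
Hypothesis be_pmf : forall j, is_pmf (@be j).

Let est j := (k j)%:R^-1 * eot (@block_cost R X Y c (k j)) eta (@al j) (@be j).

Lemma estimator_le lam j : joinings mu nu lam ->
  est j <= (1 - th j) * eoj_obj c eta lam + th j * \sum_w c w.
Proof.
move=> J; have kR : 0 < (k j)%:R :> R by rewrite ltr0n.
have cost_ge0 w : 0 <= @block_cost R X Y c (k j) w by exact: sumr_ge0.
have cost_le w : @block_cost R X Y c (k j) w <= (k j)%:R * \sum_w c w.
  apply: (@le_trans _ _ (\sum_(l < k j) \sum_w c w)).
    apply: ler_sum => l _; rewrite [leRHS](bigD1 (w.1 l, w.2 l)) //=.
    by rewrite lerDl sumr_ge0.
  by rewrite sumr_const card_ord -[leLHS]mulr_natl.
have th01 : 0 < th j <= 1 by rewrite th_gt0 th_le1.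
have := eot_le_perturb cost_ge0 (ltW eta_gt0) th01 (al_pmf j) (be_pmf j)
  (@al_dom j) (@be_dom j) (joining_coupling_coupling J (k j)) cost_le.
rewrite -(ler_pM2l (_ : 0 < (k j)%:R^-1)) ?invr_gt0 // => h; apply: (le_trans h).
rewrite mulrDr mulrCA [X in _ + X]mulrCA mulKf ?gt_eqF // lerD2r.
rewrite ler_wpM2l ?subr_ge0 //.
exact: (joining_coupling_obj c J (k_gt0 j) (ltW eta_gt0)).
Qed.

Variable d : nat -> R.
Hypothesis d_0 : d @ \oo --> (0 : R).
Hypothesis p_near_minimal : forall j,
  (k j)%:R^-1 * eot_obj (@block_cost R X Y c (k j)) eta (@p j) <= est j + d j.

(** The limit joining has an objective at most the limit of the estimators, which
    is at most the objective of any joining. It is therefore optimal, and both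
    inequalities are equalities. *)
Lemma limit_minimizing : exists t : nat -> nat, {homo t : m n / (m < n)%N} /\
  exists lam, [/\ eoj_min c eta mu nu lam,
    weak_cvg (fun n => joining_estimator (@p (t n))) lam &
    est (t n) @[n --> \oo] --> eoj c eta mu nu].
Proof.
have [t [ht [lam [J wc lb]]]] := limit_joining.
exists t; split => //; exists lam.
set C := \sum_w c w.
have dt_0 : d (t n) @[n --> \oo] --> (0 : R) by exact: cvgn_subseq ht d_0.
have tht_0 : th (t n) @[n --> \oo] --> (0 : R) by exact: cvgn_subseq ht th_0.
pose ub lam' n := (1 - th (t n)) * eoj_obj c eta lam' + th (t n) * C.
have ub_cvg lam' : ub lam' n @[n --> \oo] --> eoj_obj c eta lam'.
  have -> : eoj_obj c eta lam' = (1 - 0) * eoj_obj c eta lam' + 0 * C.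
    by rewrite subr0 mul1r mul0r addr0.
  apply: cvgD; apply: cvgM => //; try exact: cvg_cst.
  by apply: cvgB => //; exact: cvg_cst.
have min lam' : joinings mu nu lam' -> eoj_obj c eta lam <= eoj_obj c eta lam'.
  move=> J'; apply/ler_addgt0Pr => e e0; rewrite -lerBlDr.
  have cv : ub lam' n + d (t n) @[n --> \oo] --> eoj_obj c eta lam'.
    by rewrite -[X in _ --> X]addr0; exact: cvgD (ub_cvg lam') dt_0.
  apply: (cvgr_to_ge cv); have [N _ hN] := lb e e0; exists N => // n Nn.
  apply: (le_trans (hN n Nn)); apply: (le_trans (p_near_minimal (t n))).
  by rewrite lerD2r; exact: estimator_le.
have eojE : eoj c eta mu nu = eoj_obj c eta lam.
  have lbS : lbound [set eoj_obj c eta lam | lam in joinings mu nu] (eoj_obj c eta lam).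
    by move=> _ [lam' J' <-]; exact: min.
  apply/eqP; rewrite eq_le; apply/andP; split.
    by apply: ge_inf; [exists (eoj_obj c eta lam)|exists lam].
  by apply: lb_le_inf => //; exists (eoj_obj c eta lam), lam.
split=> //; rewrite eojE; apply/cvgrPdist_le => e e0.
have e2 : 0 < e / 2 by rewrite divr_gt0.
have [N1 _ h1] := lb _ e2.
have le : eoj_obj c eta lam < eoj_obj c eta lam + e by rewrite ltrDl.
have [N2 _ h2] := cvgr_le _ (ub_cvg lam) _ le.
have [N3 _ h3] := cvgr_le _ dt_0 _ e2.
exists (maxn N1 (maxn N2 N3)) => // n /=; rewrite !geq_max => /and3P[n1 n2 n3].
have := h1 n n1; have := h2 n n2; have := h3 n n3; have := estimator_le (t n) J.
have := p_near_minimal (t n); rewrite /= distrC ler_norml /ub -/C => *.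
by apply/andP; split; lra.
Qed.

End limits.

(** * Convergence of the estimators *)

Lemma cvg_of_subseq (R : realType) (u : nat -> R) (l : R) :
  (forall s : nat -> nat, {homo s : m n / (m < n)%N} ->
    exists t : nat -> nat, u (s (t n)) @[n --> \oo] --> l) ->
  u @ \oo --> l.
Proof.
move=> h; apply/cvgrPdist_lt => e e0; apply: contrapT => nh.
have /choice[f hf] : forall N, exists n, (N <= n)%N /\ e <= `|l - u n|.
  move=> N; apply: contrapT => /forallNP hN; apply: nh; exists N => // n Nn.
  by rewrite ltNge; apply/negP => le; apply: (hN n).
pose s := fix s j := if j is j'.+1 then f (s j').+1 else f 0%N.
have hs : {homo s : m n / (m < n)%N}.
  by apply: homo_ltn => [m n p|i]; [exact: ltn_trans|exact: (hf (s i).+1).1].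
have es j : e <= `|l - u (s j)| by case: j => [|j]; exact: (hf _).2.
have [t /cvgrPdist_lt/(_ e e0)[N _ hN]] := h s hs.
by have := lt_le_trans (hN N (leqnn N)) (es (t N)); rewrite ltxx.
Qed.

Theorem theorem9 (R : realType) (X Y : pfinType) (c : X * Y -> R)
    (c_ge0 : forall p, 0 <= c p)
    (mu : probability (seqsp X) R) (nu : probability (seqsp Y) R)
    (mu_stat : shift_invariant mu) (nu_stat : shift_invariant nu)
    (mu_erg : ergodic mu) (nu_erg : ergodic nu)
    (eta : R) (eta_gt0 : 0 < eta) :
  exists k : nat -> nat,
    [/\ forall n : nat, (1 <= n)%N -> (1 <= k n <= n)%N,
        k @ \oo --> \oo &
        exists (A : set (seqsp X)) (B : set (seqsp Y)),
          [/\ measurable A, mu A = 1%E, measurable B, nu B = 1%E &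
              forall x y, A x -> B y ->
                (entropic_estimator c eta (k n) n x y @[n --> \oo]
                   --> eoj c eta mu nu) /\
                (forall pi : forall n, block (k n) X * block (k n) Y -> R,
                  (forall n, (1 <= n)%N ->
                     eot_minimizers (@block_cost R X Y c (k n)) eta
                       (@empirical R X (k n) n x) (@empirical R Y (k n) n y)
                       (pi n)) ->
                  weak_cvg_set (fun n => joining_estimator (pi n))
                    (eoj_min c eta mu nu))]].
Proof.
have [N1 [A [mA A1 hA]]] := eventually_sampled_blocks mu_stat mu_erg.
have [N2 [B [mB B1 hB]]] := eventually_sampled_blocks nu_stat nu_erg.
have [k [k_gt0 k_le k_oo kN]] := slow_sequence (fun j => maxn (N1 j) (N2 j)).
exists k; split => //; first by move=> n n1; rewrite k_gt0 k_le.
exists A, B; split => // x y Ax By.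
have [K1 hK1] := hA x Ax; have [K2 hK2] := hB y By.
(* [slow_sequence] links [k n] to the thresholds only where [k n] exceeds one,
   whence the bound by two *)
have [n1 _ hn1] := k_oo _ (nbhs_infty_ge (maxn 2 (maxn K1 K2))).
pose n0 := n1.+1.
have dom n : (n0 <= n)%N ->
    (forall u, (1 - (k n).+1%:R^-1) * block_law mu u <= @empirical R X (k n) n x u) /\
    (forall v, (1 - (k n).+1%:R^-1) * block_law nu v <= @empirical R Y (k n) n y v).
  move=> /ltnW/hn1; rewrite /= !geq_max => /and3P[k2 kK1 kK2].
  have := kN n k2; rewrite geq_max => /andP[h1 h2].
  by split=> w; [exact: hK1|exact: hK2].
have cost_ge0 n w : 0 <= @block_cost R X Y c (k n) w by exact: sumr_ge0.
have emp1 n := @empirical_pmf R X (k n) n x.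
have emp2 n := @empirical_pmf R Y (k n) n y.
(* the bounds above hold from [n0] on, so subsequences start there *)
pose tail (s : nat -> nat) j := s (j + n0)%N.
have tail_homo s : {homo s : m n / (m < n)%N} -> {homo tail s : m n / (m < n)%N}.
  by move=> hs i j ij; apply: hs; rewrite ltn_add2r.
have tail_ge s j : {homo s : m n / (m < n)%N} -> (n0 <= tail s j)%N.
  by move=> hs; apply: leq_trans (homo_ltn_ge hs _); exact: leq_addl.
have key (s : nat -> nat) (hs : {homo s : m n / (m < n)%N}) (d : nat -> R)
    (p : forall j, block (k (tail s j)) X * block (k (tail s j)) Y -> R) :
  (forall j, couplings (@empirical R X (k (tail s j)) (tail s j) x)
    (@empirical R Y (k (tail s j)) (tail s j) y) (p j)) -> d @ \oo --> (0 : R) ->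
  (forall j, (k (tail s j))%:R^-1 * eot_obj (@block_cost R X Y c (k (tail s j))) eta (p j) <=
    entropic_estimator c eta (k (tail s j)) (tail s j) x y + d j) ->
  exists t : nat -> nat, {homo t : m n / (m < n)%N} /\
  exists lam, [/\ eoj_min c eta mu nu lam,
    weak_cvg (fun n => joining_estimator (p (t n))) lam &
    entropic_estimator c eta (k (tail s (t n))) (tail s (t n)) x y @[n --> \oo] -->
      eoj c eta mu nu].
  move=> cp d0 pd.
  have kt_oo : (k \o tail s) @ \oo --> \oo by apply: cvgnoo_subseq => //; exact: tail_homo.
  apply: (@limit_minimizing R X Y c eta c_ge0 eta_gt0 mu nu mu_stat nu_stat
    (k \o tail s) (fun j => @empirical R X (k (tail s j)) (tail s j) x)
    (fun j => @empirical R Y (k (tail s j)) (tail s j) y)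
    (fun j => (k (tail s j)).+1%:R^-1) p _ kt_oo _ _ _ _ _ cp _ _ d d0 pd) => //=.
  - by move=> j; rewrite invf_le1 ?ler1n ?ltr0n.
  - apply: (@cvg_inv_length R (fun j => (k (tail s j)).+1)) => S [N _ hN].
    have [M _ hM] := kt_oo _ (nbhs_infty_ge N).
    by exists M => // j /hM /= Nk; apply: hN => /=; exact: leqW.
  - by move=> j u; have [h _] := dom _ (tail_ge s j hs); exact: h.
  - by move=> j v; have [_ h] := dom _ (tail_ge s j hs); exact: h.
split.
  apply: cvg_of_subseq => s hs.
  have P j : {p | couplings (@empirical R X (k (tail s j)) (tail s j) x)
        (@empirical R Y (k (tail s j)) (tail s j) y) p /\
      eot_obj (@block_cost R X Y c (k (tail s j))) eta p <
      eot (@block_cost R X Y c (k (tail s j))) eta (@empirical R X (k (tail s j)) (tail s j) x)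
        (@empirical R Y (k (tail s j)) (tail s j) y) + j.+1%:R^-1}.
    apply: cid; have j0 : 0 < j.+1%:R^-1 :> R by rewrite invr_gt0.
    have [p cp lt] := eot_near_minimizer (cost_ge0 (tail s j)) (ltW eta_gt0)
      (emp1 (tail s j)) (emp2 (tail s j)) j0.
    by exists p.
  have [|||t [_ [lam [_ _ cv]]]] := key s hs (fun j => j.+1%:R^-1) (fun j => sval (P j)).
  - by move=> j; exact: (svalP (P j)).1.
  - exact: cvg_harmonic.
  - move=> j; have kR : 0 < (k (tail s j))%:R :> R by rewrite ltr0n.
    rewrite /entropic_estimator -(ler_pM2l kR) [leRHS]mulrDr.
    rewrite !mulVKf ?gt_eqF //.
    apply: (le_trans (ltW (svalP (P j)).2)); rewrite lerD2l ler_peMl ?ler1n //.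
  by exists (fun n => (t n + n0)%N).
move=> pi pi_min s hs.
have pi_min' j : eot_minimizers (@block_cost R X Y c (k (tail s j))) eta
    (@empirical R X (k (tail s j)) (tail s j) x)
    (@empirical R Y (k (tail s j)) (tail s j) y) (pi (tail s j)).
  by apply: pi_min; apply: leq_trans (tail_ge s j hs).
have [|||t [ht [lam [lam_min wc _]]]] := key s hs (fun=> 0) (fun j => pi (tail s j)).
- by move=> j; exact: (pi_min' j).1.
- exact: cvg_cst.
- move=> j; rewrite addr0 ler_wpM2l ?invr_ge0 ?ler0n //.
  apply: lb_le_inf.
    exists (eot_obj (@block_cost R X Y c (k (tail s j))) eta (pi (tail s j))).
    by exists (pi (tail s j)) => //; exact: (pi_min' j).1.
  by move=> _ [q cq <-]; exact: (pi_min' j).2.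
exists (fun n => (t n + n0)%N); split; first by move=> i j ij; rewrite ltn_add2r ht.
by exists lam.
Qed.
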